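(* Let $\mathcal{X},\mathcal{Y},\mathcal{Z}$ be finite sets, $P_{Y,Z|X}$ a channel from $\mathcal{X}$ to $\mathcal{Y}\times\mathcal{Z}$, $\mathsf{C}:\mathcal{X}\to\mathbb{R}_{\geq 0}$ a cost function and $b\geq \mathsf{c}_{\min}:=\min_{x\in\mathcal{X}}\mathsf{C}(x)$. Then the weak-secrecy capacity, the strong-secrecy capacity and the semantic-security capacity of the cost-constrained wiretap channel $(\mathcal{X},\mathcal{Y},\mathcal{Z},P_{Y,Z|X},\mathsf{C},b)$ coincide and equal $\bar C(b)$: $$C_{\mathsf{sem}}(b)=C_{\mathsf{str}}(b)=C_{\mathsf{weak}}(b)=\bar C(b),$$ where $$\bar C(b):=\sup\Big\{ I_P(V;Y|U)-I_P(V;Z|U)\Big\},$$ the supremum being over all finite sets $\mathcal{U},\mathcal{V}$ and all PMFs $P_{U,V,X}$ on $\mathcal{U}\times\mathcal{V}\times\mathcal{X}$ with $P_{U,V,X}=P_{U,V}P_{X|V}$ (i.e. $U-V-X$ is a Markov chain) and $\mathbb{E}_P[\mathsf{C}(X)]\leq b$, and the mutual informations are computed under $P=P_{U,V,X}P_{Y,Z|X}$.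
   Context: Cost-constrained wiretap channel (CC WTC) setup. For $n\in\mathbb{N}$ and $R\ge 0$, let $\mathcal{M}_n:=\{m\in\mathbb{N}:1\le m\le 2^{nR}\}$. An $(n,R)$-code $c_n=(f_n,g_n)$ consists of a stochastic encoder $f_n:\mathcal{M}_n\to\mathcal{P}(\mathcal{X}^n)$ satisfying the per-message cost constraint $\sum_{\mathbf{x}\in\mathcal{X}^n} f_n(\mathbf{x}|m)\,\mathsf{C}_n(\mathbf{x})\le b$ for all $m\in\mathcal{M}_n$, where $\mathsf{C}_n(\mathbf{x}):=\frac1n\sum_{i=1}^n\mathsf{C}(x_i)$, and a decoder $g_n:\mathcal{Y}^n\to\mathcal{M}_n$. A message PMF $P_M$ and the code induce the joint PMF $P_M(m)f_n(\mathbf{x}|m)P_{Y,Z|X}^{\otimes n}(\mathbf{y},\mathbf{z}|\mathbf{x})\mathbb{1}\{\hat m=g_n(\mathbf{y})\}$ (memoryless channel). The maximal error probability is $e(c_n):=\max_m \sum_{\mathbf{x}}f_n(\mathbf{x}|m)\sum_{\mathbf{y}:g_n(\mathbf{y})\neq m}P^{\otimes n}_{Y|X}(\mathbf{y}|\mathbf{x})$. The leakage is $\ell(P_M,c_n):=I(M;\mathbf{Z})$ under the induced PMF. With $\bar P_M$ uniform on $\mathcal{M}_n$: $\ell_{\mathsf{weak}}(c_n):=\frac1n\ell(\bar P_M,c_n)$, $\ell_{\mathsf{str}}(c_n):=\ell(\bar P_M,c_n)$, $\ell_{\mathsf{sem}}(c_n):=\max_{P_M\in\mathcal{P}(\mathcal{M}_n)}\ell(P_M,c_n)$.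 A rate $R$ is achievable under a given metric $\ell_\ast$ if for every $\epsilon>0$ and all sufficiently large $n$ there is an $(n,R)$-code satisfying the per-message cost constraint and $\max\{e(c_n),\ell_\ast(c_n)\}\le\epsilon$. $C_{\mathsf{sem}}(b)$, $C_{\mathsf{str}}(b)$, $C_{\mathsf{weak}}(b)$ denote the suprema of rates achievable under $\ell_{\mathsf{sem}},\ell_{\mathsf{str}},\ell_{\mathsf{weak}}$ respectively. *)

(* Defs.v *)
From HB Require Import structures.
From mathcomp Require Import all_boot all_order all_algebra.
From mathcomp Require Import all_classical all_reals all_analysis.
Set Implicit Arguments. Unset Strict Implicit. Unset Printing Implicit Defensive.
Import Order.TTheory GRing.Theory Num.Theory.
Local Open Scope ring_scope.

Section Defs.
Variable R : realType.

Definition log2 (x : R) : R := ln x / ln 2.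

Definition is_pmf (A : finType) (p : A -> R) : Prop :=
  (forall a, 0 <= p a) /\ \sum_(a : A) p a = 1.

Definition is_kernel (A B : finType) (q : A -> B -> R) : Prop :=
  forall a, is_pmf (q a).

Definition is_channel (X Y Z : finType) (W : X -> Y -> Z -> R) : Prop :=
  forall x, (forall y z, 0 <= W x y z) /\ \sum_(y : Y) \sum_(z : Z) W x y z = 1.

Definition mutinfo (A B : finType) (p : A -> B -> R) : R :=
  let pA := fun a => \sum_(b : B) p a b in
  let pB := fun b => \sum_(a : A) p a b in
  \sum_(a : A) \sum_(b : B)
     (if p a b == 0 then 0 else p a b * log2 (p a b / (pA a * pB b))).

Definition cmutinfo (A B C : finType) (p : A -> B -> C -> R) : R :=
  let pA := fun a => \sum_(b : B) \sum_(c : C) p a b c in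
  let pAB := fun a b => \sum_(c : C) p a b c in
  let pAC := fun a c => \sum_(b : B) p a b c in
  \sum_(a : A) \sum_(b : B) \sum_(c : C)
     (if p a b c == 0 then 0
      else p a b c * log2 (p a b c * pA a / (pAB a b * pAC a c))).

Variables (X Y Z : finType) (W : X -> Y -> Z -> R) (cost : X -> R).

Definition WY (x : X) (y : Y) : R := \sum_(z : Z) W x y z.
Definition WZ (x : X) (z : Z) : R := \sum_(y : Y) W x y z.

(* c_min = min_x C(x); x0 is any element used as seed of the iterated min *)
Definition cmin (x0 : X) : R := \big[Num.min/cost x0]_(x : X) cost x.

(* |M_n| = #{m in N : 1 <= m <= 2^{nR}} = floor(2^{nR}); messages are 'I_(msize n Rt) *)
Definition msize (n : nat) (Rt : R) : nat := Num.truncn (2 `^ (n%:R * Rt)).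

Definition costn (n : nat) (x : {ffun 'I_n -> X}) : R :=
  n%:R^-1 * \sum_(i < n) cost (x i).

Definition WYn (n : nat) (x : {ffun 'I_n -> X}) (y : {ffun 'I_n -> Y}) : R :=
  \prod_(i < n) WY (x i) (y i).
Definition WZn (n : nat) (x : {ffun 'I_n -> X}) (z : {ffun 'I_n -> Z}) : R :=
  \prod_(i < n) WZ (x i) (z i).

Definition valid_code (b : R) (n K : nat)
    (f : 'I_K -> {ffun 'I_n -> X} -> R) : Prop :=
  is_kernel f /\
  forall m, \sum_(x : {ffun 'I_n -> X}) f m x * costn x <= b.

Definition max_err (n K : nat) (f : 'I_K -> {ffun 'I_n -> X} -> R)
    (g : {ffun 'I_n -> Y} -> 'I_K) : R :=
  \big[Num.max/0]_(m : 'I_K)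
     \sum_(x : {ffun 'I_n -> X}) f m x *
        \sum_(y : {ffun 'I_n -> Y} | g y != m) WYn x y.

Definition leakage (n K : nat) (PM : 'I_K -> R)
    (f : 'I_K -> {ffun 'I_n -> X} -> R) : R :=
  mutinfo (fun (m : 'I_K) (z : {ffun 'I_n -> Z}) =>
     PM m * \sum_(x : {ffun 'I_n -> X}) f m x * WZn x z).

Definition unifM (K : nat) (m : 'I_K) : R := K%:R^-1.

Definition leak_weak (n K : nat) (f : 'I_K -> {ffun 'I_n -> X} -> R) : \bar R :=
  (n%:R^-1 * leakage (@unifM K) f)%:E.
Definition leak_str (n K : nat) (f : 'I_K -> {ffun 'I_n -> X} -> R) : \bar R :=
  (leakage (@unifM K) f)%:E.
Definition leak_sem (n K : nat) (f : 'I_K -> {ffun 'I_n -> X} -> R) : \bar R :=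
  ereal_sup [set (leakage PM f)%:E | PM in [set PM : 'I_K -> R | is_pmf PM]].

Definition achievable
    (leak : forall n K : nat, ('I_K -> {ffun 'I_n -> X} -> R) -> \bar R)
    (b Rt : R) : Prop :=
  0 <= Rt /\
  forall eps : R, 0 < eps -> exists N : nat, forall n : nat, (N <= n)%N ->
    exists (f : 'I_(msize n Rt) -> {ffun 'I_n -> X} -> R)
           (g : {ffun 'I_n -> Y} -> 'I_(msize n Rt)),
      valid_code b f /\ max_err f g <= eps /\ (leak n _ f <= eps%:E)%E.

Definition capacity
    (leak : forall n K : nat, ('I_K -> {ffun 'I_n -> X} -> R) -> \bar R)
    (b : R) : \bar R :=
  ereal_sup [set Rt%:E | Rt in [set Rt | achievable leak b Rt]].

Definition C_weak (b : R) := capacity leak_weak b.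
Definition C_str (b : R) := capacity leak_str b.
Definition C_sem (b : R) := capacity leak_sem b.

Definition secrecy_value (U V : finType) (pUV : U -> V -> R) (q : V -> X -> R) : R :=
  let P := fun u v x => pUV u v * q v x in
  cmutinfo (fun u v (y : Y) => \sum_(x : X) P u v x * WY x y) -
  cmutinfo (fun u v (z : Z) => \sum_(x : X) P u v x * WZ x z).

Definition Cbar (b : R) : \bar R :=
  ereal_sup [set r%:E | r in [set r : R |
    exists (U V : finType) (pUV : U -> V -> R) (q : V -> X -> R),
      is_pmf (fun uv : U * V => pUV uv.1 uv.2) /\ is_kernel q /\
      \sum_(u : U) \sum_(v : V) \sum_(x : X) pUV u v * q v x * cost x <= b /\
      r = secrecy_value pUV q]].

End Defs.

(* Main.v *)
(* Secrecy metrics are ordered, so C_sem <= C_str <= C_weak, and it remains to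
   prove C_weak <= Cbar <= C_sem.

   Converse. Let S^k be the output whose first k coordinates come from the
   legitimate channel and whose other coordinates come from the eavesdropper's.
   Then I(M;Y^n) - I(M;Z^n) telescopes into the sum of I(M;S^(i+1)) - I(M;S^i);
   these two outputs share everything but coordinate i, so with T_i the common
   part the difference is I(M;Y_i|T_i) - I(M;Z_i|T_i) by the chain rule. Taking
   U = (i,T_i) with i uniform and V = (U,M) turns the sum into n times one value
   of the supremum.

   Achievability. Draw u^n, then, given u^n, a codebook v(m,l) of independent
   words, where l is local randomness. With w the channel from V, Q its output
   law given u, and kappa words in total, of which L for each message, the
   inequalities
     E err <= E log2 (1 + kappa Q(y)/w(y|v)),
     E D(P_{Z|M=m} || Q) <= E ln (1 + w(z|v)/(L Q(z)))
   follow from Jensen's inequality for the concave logarithm. Both right-hand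
   sides vanish exponentially: ln (1 + x) <= x^s/s makes them products of
   one-letter moments E r^s, which are exp(s E ln r + O(s^2)). No typicality
   argument is needed. Cost, error probability and divergence are added up into
   one score per message with mean below 1, and expurgation keeps a constant
   fraction of messages for which all three are small. The divergence bound
   controls the leakage for every message law. A cost budget above the minimum
   is made slack by mixing with a cheapest letter; at the minimum only cheapest
   letters are used. *)

Require Import Defs.
From HB Require Import structures.
From mathcomp Require Import all_boot all_order all_algebra.
From mathcomp Require Import all_classical all_reals all_analysis.
From mathcomp Require Import ring lra.
Set Implicit Arguments. Unset Strict Implicit. Unset Printing Implicit Defensive.
Import Order.TTheory GRing.Theory Num.Theory.
Local Open Scope ring_scope.
(** * Inequalities for logarithms and kernels *)

Section Analysis.
Variable R : realType.
Implicit Types (s x y : R).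

Lemma ln2_gt0 : 0 < ln 2 :> R.
Proof. by rewrite ln_gt0 ?ltr1n. Qed.

Lemma ln_le_subr1 x : 0 < x -> ln x <= x - 1.
Proof.
move=> x0; have := @le_ln1Dx R (x - 1).
by rewrite addrCA subrr addr0; apply; lra.
Qed.

Lemma ln_tangent x y : 0 < x -> 0 < y -> ln x <= ln y + (x - y) / y.
Proof.
move=> x0 y0; have := @ln_le_subr1 (x / y) (divr_gt0 x0 y0).
rewrite ln_div ?posrE// mulrBl divff ?gt_eqF//; lra.
Qed.

Lemma ln_ge_subV x : 0 < x -> 1 - x^-1 <= ln x.
Proof.
move=> x0; have := @ln_le_subr1 x^-1; rewrite invr_gt0 => /(_ x0).
by rewrite lnV ?posrE//; lra.
Qed.

(** For [x <= 1], [ln (1 + x) <= x <= x^s]. For [x > 1], [ln (1 + x) <= ln 2 + ln x] and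
    [ln x <= (x^s - 1) / s]; the term [- 1/s] absorbs [ln 2 <= 1]. *)
Lemma ln1D_le_powR s x : 0 < s -> s <= 1 -> 0 <= x -> ln (1 + x) <= x `^ s / s.
Proof.
move=> s0 s1; rewrite le_eqVlt => /predU1P[<-|x0].
  by rewrite addr0 ln1 divr_ge0 ?powR_ge0 ?ltW.
have pV : 1 <= s^-1 by rewrite invf_ge1.
have [x1|x1] := leP x 1.
  have xs : x <= x `^ s.
    have := @ger_powR R x; rewrite x0 x1 => /(_ isT s 1 s1).
    by rewrite (powRr1 (ltW x0)).
  have : ln (1 + x) <= x by apply: le_ln1Dx; lra.
  have : x `^ s * 1 <= x `^ s / s by rewrite ler_wpM2l ?powR_ge0.
  lra.
have h1 : ln (1 + x) <= ln 2 + ln x.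
  by rewrite -lnM ?posrE// ler_ln ?posrE; lra.
have h2 : ln 2 <= 1 :> R by have := @ln_le_subr1 2; lra.
have h3 : ln x <= (x `^ s - 1) / s.
  rewrite ler_pdivlMr// mulrC -ln_powR.
  by apply: ln_le_subr1; rewrite powR_gt0.
move: h3; rewrite mulrBl mul1r; lra.
Qed.

Lemma powR_prod (I : finType) (F : I -> R) s : (forall i, 0 <= F i) ->
  (\prod_i F i) `^ s = \prod_i (F i `^ s).
Proof.
move=> F0; suff [] : 0 <= \prod_i F i /\ (\prod_i F i) `^ s = \prod_i (F i `^ s) by [].
apply: (big_rec2 (fun a b => 0 <= a /\ a `^ s = b)); first by rewrite powR1.
move=> i a b _ [a0 <-]; split; first exact: mulr_ge0.
by rewrite powRM.
Qed.

(** [exp (-x) >= 1 - x] gives [exp x (1 - x) <= 1], while [(1 + x + 2 x^2)(1 - x) = 1 + x^2 (1 - 2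
    x)] is at least 1 on this range. *)
Lemma expR_le_quad x : x <= 1 / 2 -> expR x <= 1 + x + 2 * x ^+ 2.
Proof.
move=> x1; have h := @expR_ge1Dx R (- x); rewrite expRN in h.
have e0 := expR_gt0 x.
have h1 : expR x * (1 - x) <= 1.
  by rewrite mulrC -ler_pdivlMr// mul1r.
have h2 : 1 <= (1 + x + 2 * x ^+ 2) * (1 - x) by nra.
have := le_trans h1 h2; rewrite ler_pM2r //; lra.
Qed.

(** By [expR_le_quad], [r^s = exp (s ln r)] exceeds [1 + s ln r] by at most a quadratic error, which
    is below [s d] once [s] is small. The exponent is thus the first-order one up to [d], with [s]
    depending on one-letter data only. *)
Lemma moment_bound (T : finType) (p r : T -> R) (d : R) :
  is_pmf p -> (forall t, 0 <= r t) -> (forall t, p t != 0 -> 0 < r t) -> 0 < d ->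
  exists s, [/\ 0 < s, s <= 1 &
    \sum_t p t * r t `^ s <= expR (s * (\sum_t p t * ln (r t) + d))].
Proof.
move=> [p0 p1] r0 rp d0.
set B := \sum_t `|ln (r t)|; have B0 : 0 <= B by apply: sumr_ge0.
have rB t : `|ln (r t)| <= B.
  by rewrite /B (bigD1 t)//= lerDl sumr_ge0.
(* With [s = 1/D], the three summands give in turn [s <= 1], [s B <= 1/2] (the range of
   [expR_le_quad]) and [2 s B^2 <= d]. *)
set D := 1 + 2 * B + 2 * B ^+ 2 / d.
have hB : 0 <= 2 * B ^+ 2 / d.
  by apply: divr_ge0; [apply: mulr_ge0; rewrite ?sqr_ge0|exact: ltW].
have D1 : 1 <= D by rewrite /D; lra.
have D0 : 0 < D by lra.
exists D^-1; split; rewrite ?invr_gt0 ?invf_le1//.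
set s := D^-1; have s0 : 0 < s by rewrite invr_gt0.
have sD : s * D = 1 by rewrite mulVf ?gt_eqF.
have sB : s * B <= 1 / 2.
  have : s * (2 * B) <= s * D by rewrite ler_wpM2l ?ltW// /D; lra.
  lra.
have sd : s * (2 * B ^+ 2) <= d.
  have : s * (2 * B ^+ 2 / d) <= s * D by rewrite ler_wpM2l ?ltW// /D; lra.
  by rewrite sD mulrA ler_pdivrMr// mul1r.
apply: (@le_trans _ _ (1 + s * (\sum_t p t * ln (r t) + d))); last exact: expR_ge1Dx.
apply: (@le_trans _ _ (\sum_t (p t + s * (p t * ln (r t)) + s * d * p t))).
  apply: ler_sum => t _.
  have [->|pt] := eqVneq (p t) 0; first by rewrite !mul0r !mulr0 !addr0.
  have rt := rp _ pt.
  rewrite /powR gt_eqF//.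
  have lB := rB t; move: lB; rewrite ler_norml => /andP[lB1 lB2].
  have h : s * ln (r t) <= 1 / 2.
    by apply: le_trans sB; rewrite ler_wpM2l// ltW.
  have sq : ln (r t) ^+ 2 <= B ^+ 2 by rewrite -real_normK ?num_real// lerXn2r ?nnegrE.
  have h1 : 2 * (s * ln (r t)) ^+ 2 <= s * d.
    rewrite exprMn mulrCA [s ^+ 2]expr2 -mulrA ler_wpM2l ?(ltW s0)//.
    apply: le_trans sd; rewrite ler_wpM2l ?(ltW s0)//; lra.
  have := expR_le_quad h => h2.
  have -> : p t + s * (p t * ln (r t)) + s * d * p t = p t * (1 + s * ln (r t) + s * d) by ring.
  by rewrite ler_wpM2l//; lra.
rewrite !big_split/= -!mulr_sumr p1; lra.
Qed.

Lemma sum_pair (A B : finType) (F : A * B -> R) :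
  \sum_p F p = \sum_a \sum_b F (a, b).
Proof. by rewrite pair_bigA; apply: eq_bigr => -[]. Qed.

(** Termwise [p ln (p/q) >= p - q], from [1 - 1/x <= ln x]; it remains to compare total masses. *)
Lemma gibbs (A : finType) (p q : A -> R) :
  (forall a, 0 <= p a) -> (forall a, 0 <= q a) -> (forall a, p a != 0 -> q a != 0) ->
  \sum_a q a <= \sum_a p a -> 0 <= \sum_a p a * ln (p a / q a).
Proof.
move=> p0 q0 pq le.
apply: (@le_trans _ _ (\sum_a (p a - q a))); first by rewrite sumrB subr_ge0.
apply: ler_sum => a _; have [->|pa] := eqVneq (p a) 0.
  by rewrite mul0r sub0r oppr_le0.
have pp : 0 < p a by rewrite lt_neqAle eq_sym pa p0.
have qq : 0 < q a by rewrite lt_neqAle eq_sym pq// q0.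
have := ln_ge_subV (divr_gt0 pp qq); rewrite invf_div => h.
have : p a * (1 - q a / p a) <= p a * ln (p a / q a) by rewrite ler_wpM2l.
by rewrite mulrBr mulr1 mulrCA divff// mulr1.
Qed.

(** The case distinction for [0 log 0] disappears because [ln] is total and its factor vanishes
    there. Computations are done in nats from here on. *)
Lemma mutinfoE (A B : finType) (p : A -> B -> R) :
  mutinfo p = (\sum_a \sum_b p a b *
     ln (p a b / ((\sum_b' p a b') * (\sum_a' p a' b)))) / ln 2.
Proof.
rewrite /mutinfo mulr_suml; apply: eq_bigr => a _.
rewrite mulr_suml; apply: eq_bigr => b _.
by rewrite /log2; case: eqVneq => [->|_]; rewrite ?mul0r// mulrA.
Qed.

Lemma cmutinfoE (A B C : finType) (p : A -> B -> C -> R) :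
  cmutinfo p = (\sum_a \sum_b \sum_c p a b c *
     ln (p a b c * (\sum_b' \sum_c' p a b' c') /
         ((\sum_c' p a b c') * (\sum_b' p a b' c)))) / ln 2.
Proof.
rewrite /cmutinfo mulr_suml; apply: eq_bigr => a _.
rewrite mulr_suml; apply: eq_bigr => b _.
rewrite mulr_suml; apply: eq_bigr => c _.
by rewrite /log2; case: eqVneq => [->|_]; rewrite ?mul0r// mulrA.
Qed.

Lemma kernel_comp (A B C : finType) (p : A -> B -> R) (w : B -> C -> R) :
  is_kernel p -> is_kernel w -> is_kernel (fun a c => \sum_b p a b * w b c).
Proof.
move=> pP wP a; split=> [c|].
  by apply: sumr_ge0 => b _; rewrite mulr_ge0//; [case: (pP a)|case: (wP b)].
rewrite exchange_big/= -[RHS](pP a).2; apply: eq_bigr => b _.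
by rewrite -mulr_sumr (wP b).2 mulr1.
Qed.

Lemma kernel_prod (A B : finType) (n : nat) (w : A -> B -> R) : is_kernel w ->
  is_kernel (fun (x : {ffun 'I_n -> A}) (y : {ffun 'I_n -> B}) => \prod_i w (x i) (y i)).
Proof.
move=> wP x; split=> [y|]; first by apply: prodr_ge0 => i _; case: (wP (x i)).
by rewrite -(bigA_distr_bigA (fun i => w (x i))) big1// => i _; case: (wP (x i)).
Qed.

Lemma WY_kernel (X Y Z : finType) (W : X -> Y -> Z -> R) : is_channel W -> is_kernel (WY W).
Proof.
by move=> WP x; split; [move=> y; apply: sumr_ge0 => z _|]; case: (WP x).
Qed.

Lemma WZ_kernel (X Y Z : finType) (W : X -> Y -> Z -> R) : is_channel W -> is_kernel (WZ W).
Proof.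
move=> WP x; split; first by move=> z; apply: sumr_ge0 => y _; case: (WP x).
by rewrite exchange_big/=; case: (WP x).
Qed.

Lemma msize_gt0 (n : nat) (r : R) : 0 <= r -> (0 < msize n r)%N.
Proof.
move=> r0; rewrite truncn_gt0.
have := @ler_powR R 2 (ler1n _ 2) 0 (n%:R * r); rewrite powRr0; apply.
exact: mulr_ge0.
Qed.

Lemma msize_le (n : nat) (r : R) : (msize n r)%:R <= expR (n%:R * r * ln 2).
Proof.
have := truncn_le (2 `^ (n%:R * r) : R); rewrite powR_ge0 => h.
by rewrite (le_trans h)// /powR pnatr_eq0.
Qed.

(** Rounding down costs at most one bit: [2^(n r) < K + 1 <= 2 K] for the message count [K]. *)
Lemma ln_msize_ge (n : nat) (r : R) : 0 <= r ->
  n%:R * r * ln 2 - ln 2 <= ln (msize n r)%:R.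
Proof.
move=> r0; have k0 := msize_gt0 n r0.
have kr : (1 : R) <= (msize n r)%:R by rewrite ler1n.
rewrite lerBlDr -lnM ?posrE ?ltr0n// -ln_powR ler_ln ?posrE ?powR_gt0 ?mulr_gt0 ?ltr0n//.
have /andP[_ h] := truncn_itv (powR_ge0 2 (n%:R * r) : 0 <= _ :> R).
apply: le_trans (ltW h) _; rewrite -[Num.trunc _]/(msize n r) -natr1; lra.
Qed.

End Analysis.

(** * Converse *)

Section InformationMeasures.
Variable R : realType.

(* Fano's inequality in the form needed here is Gibbs' inequality against the
   posterior that puts weight 1/2 on the decoded message and spreads the other
   1/2 uniformly. *)
Lemma mutinfo_fano (K : nat) (Y : finType) (w : 'I_K -> Y -> R) (g : Y -> 'I_K)
    (e : R) :
  (0 < K)%N -> is_kernel w -> (forall m, \sum_(y | g y != m) w m y <= e) ->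
  (1 - e) * ln K%:R - ln 2 <= ln 2 * mutinfo (fun m y => K%:R^-1 * w m y).
Proof.
move=> K0 wP we.
have Kp : 0 < K%:R :> R by rewrite ltr0n.
have KV : 0 < K%:R^-1 :> R by rewrite invr_gt0.
have w0 m y : 0 <= w m y by case: (wP m).
have w1 m : \sum_y w m y = 1 by case: (wP m).
rewrite mutinfoE [ln 2 * _]mulrC divfK ?gt_eqF ?ln2_gt0//.
set Q := fun y => \sum_m K%:R^-1 * w m y.
pose k (m : 'I_K) y : R := 2^-1 * (g y == m)%:R + 2^-1 * K%:R^-1.
pose p (a : 'I_K * Y) := K%:R^-1 * w a.1 a.2.
pose q (a : 'I_K * Y) := Q a.2 * k a.1 a.2.
have p0 a : 0 <= p a by rewrite mulr_ge0// ltW.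
have k0 m y : 0 < k m y.
  by rewrite ltr_wpDl ?mulr_gt0 ?mulr_ge0 ?invr_ge0 ?invr_gt0 ?ler0n ?ltr0n.
have Q0 y : 0 <= Q y by apply: sumr_ge0 => m _; exact: (p0 (m, y)).
have Qp m y : w m y != 0 -> 0 < Q y.
  move=> wmy; rewrite lt_neqAle eq_sym Q0 andbT.
  apply: contraNneq wmy => /(psumr_eq0P (fun m _ => p0 (m, y))) /(_ m isT)/eqP.
  by rewrite mulf_eq0 gt_eqF.
have G : 0 <= \sum_a p a * ln (p a / q a).
  apply: gibbs => // [a|[m y]|].
  - by rewrite mulr_ge0// ltW.
  - rewrite /p/= mulf_eq0 gt_eqF//= => wmy; rewrite mulf_neq0 ?gt_eqF//.
    exact: Qp wmy.
  rewrite -(pair_bigA _ (fun m y => Q y * k m y))/= exchange_big/=.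
  rewrite -(pair_bigA _ (fun m y => K%:R^-1 * w m y))/= [leRHS]exchange_big/=.
  apply: ler_sum => y _; rewrite -mulr_sumr big_split/= -mulr_sumr.
  rewrite sumr_const card_ord (bigD1 (g y))//= eqxx big1 => [|m]; last first.
    by rewrite eq_sym => /negbTE ->.
  rewrite addr0 mulr1 -[_ *+ K]mulr_natr -mulrA mulVf ?gt_eqF// mulr1.
  by rewrite (_ : _^-1 + _ = 1) ?mulr1//; field.
rewrite -(pair_bigA _ (fun m y => K%:R^-1 * w m y * ln (K%:R^-1 * w m y / (Q y * k m y)))) in G.
(* Gibbs' inequality replaces the true posterior by [k]. The remaining integrand [ln (K k)] is at
   least [ln K - ln 2] when [y] is decoded to [m] and equals [- ln 2] otherwise. *)
apply: (@le_trans _ _ (\sum_(m < K) \sum_y K%:R^-1 * w m y * ln (K%:R * k m y))).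
  have -> : (1 - e) * ln K%:R - ln 2 =
      \sum_(m < K) K%:R^-1 * ((1 - e) * ln K%:R - ln 2).
    by rewrite sumr_const card_ord -[RHS]mulr_natr mulrAC mulVf ?gt_eqF// mul1r.
  apply: ler_sum => m _.
  under eq_bigr do rewrite -mulrA.
  rewrite -mulr_sumr ler_pM2l//.
  apply: (@le_trans _ _ (\sum_y w m y * ((g y == m)%:R * ln K%:R - ln 2))).
    under eq_bigr do rewrite mulrBr mulrA.
    rewrite sumrB -!mulr_suml w1 mul1r lerB// ler_wpM2r ?ln_ge0 ?ler1n//.
    have : \sum_y w m y * (g y == m)%:R + \sum_(y | g y != m) w m y = \sum_y w m y.
      rewrite [RHS](bigID (fun y => g y == m))/=; congr (_ + _).
      rewrite [RHS]big_mkcond; apply: eq_bigr => y _.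
      by case: eqP; rewrite ?mulr1 ?mulr0.
    by rewrite w1; have := we m; lra.
  apply: ler_sum => y _; rewrite ler_wpM2l//.
  case: eqVneq => e1; rewrite ?mul1r ?mul0r ?sub0r -?lnV ?posrE//.
    rewrite -lnM ?posrE// ?invr_gt0// ler_ln ?posrE ?mulr_gt0 ?invr_gt0//.
    rewrite /k e1 eqxx mulr1 ler_pM2l// lerDl mulr_ge0 ?invr_ge0//; lra.
  rewrite ler_ln ?posrE ?mulr_gt0 ?invr_gt0//.
  by rewrite /k (negbTE e1) mulr0 add0r mulrCA mulfV ?gt_eqF// mulr1.
rewrite -subr_ge0; apply: le_trans G _; rewrite -sumrB; apply: ler_sum => m _.
rewrite -sumrB; apply: ler_sum => y _; rewrite -mulrBr.
have [->|wmy] := eqVneq (w m y) 0; first by rewrite !mulr0 !mul0r.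
have wp : 0 < w m y by rewrite lt_neqAle eq_sym wmy w0.
have Qy := Qp _ _ wmy; have ky := k0 m y.
rewrite -ln_div ?posrE ?divr_gt0 ?mulr_gt0//; last first.
  by rewrite -mulr_sumr w1 mulr1.
rewrite -mulr_sumr w1 mulr1 le_eqVlt; apply/orP; left; apply/eqP; congr (_ * ln _).
by rewrite -/(Q y); field; rewrite !gt_eqF.
Qed.

(** The logarithms add up term by term on the support of [p], where all marginals involved are
    positive. *)
Lemma mutinfo_chain (M T C : finType) (p : M -> T -> C -> R) :
  (forall m t c, 0 <= p m t c) ->
  mutinfo (fun m (tc : T * C) => p m tc.1 tc.2) =
  mutinfo (fun m t => \sum_c p m t c) + cmutinfo (fun t m c => p m t c).
Proof.
move=> p0; rewrite !mutinfoE cmutinfoE -mulrDl; congr (_ / _).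
rewrite [X in _ + X]exchange_big/= -big_split/=; apply: eq_bigr => m _.
rewrite -(pair_bigA _ (fun t c => p m t c * ln (p m t c /
  ((\sum_(b' : T * C) p m b'.1 b'.2) * (\sum_a' p a' t c)))))/= -big_split/=.
apply: eq_bigr => t _; rewrite mulr_suml -big_split/=; apply: eq_bigr => c _.
have [->|pn] := eqVneq (p m t c) 0; first by rewrite !mul0r addr0.
have pp : 0 < p m t c by rewrite lt_neqAle eq_sym pn p0.
have ple (I : finType) (F : I -> R) i : (forall i, 0 <= F i) -> F i <= \sum_i F i.
  by move=> F0; rewrite (bigD1 i)//= lerDl sumr_ge0.
rewrite -mulrDr -(pair_bigA _ (fun t c => p m t c))/=.
have a0 : 0 < \sum_c p m t c by apply: lt_le_trans pp _; apply: (ple _ (p m t)).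
have b0 : 0 < \sum_t \sum_c p m t c.
  by apply: lt_le_trans a0 _; apply: (ple _ (fun t => \sum_c p m t c)) => ?; apply: sumr_ge0.
have c0 : 0 < \sum_m p m t c by apply: lt_le_trans pp _; apply: (ple _ (fun m => p m t c)).
have d0 : 0 < \sum_m \sum_c p m t c.
  by apply: lt_le_trans a0 _; apply: (ple _ (fun m => \sum_c p m t c)) => ?; apply: sumr_ge0.
rewrite -lnM ?posrE ?divr_gt0 ?mulr_gt0//; congr (_ * ln _).
by field; rewrite !gt_eqF.
Qed.

Lemma sum_inj_support (B B' : finType) (e : B -> B') (F : B' -> R) : injective e ->
  (forall b', (forall b, e b != b') -> F b' = 0) -> \sum_b' F b' = \sum_b F (e b).
Proof.
move=> ei F0.
have -> : \sum_b' F b' = \sum_(b' in imset e (mem predT)) F b'.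
  rewrite [RHS]big_mkcond; apply: eq_bigr => b' _; case: ifPn => // nb.
  apply: F0 => b; apply: contraNneq nb => <-; exact: imset_f.
by rewrite big_imset//=; move=> x y _ _; exact: ei.
Qed.

(** Relabelling of outputs. It embeds both output alphabets into a common one, and it splits an
    output word into its erased version and the erased letter. *)
Lemma mutinfo_inj (M B B' : finType) (e : B -> B') (p : M -> B -> R)
    (p' : M -> B' -> R) : injective e ->
  (forall m b, p' m (e b) = p m b) ->
  (forall m b', (forall b, e b != b') -> p' m b' = 0) ->
  mutinfo p' = mutinfo p.
Proof.
move=> ei pe p0; rewrite !mutinfoE; congr (_ / _); apply: eq_bigr => m _.
rewrite [LHS](sum_inj_support ei) => [|b' H]; last by rewrite p0// mul0r.
apply: eq_bigr => b _; rewrite pe (sum_inj_support ei (p0 m)).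
by rewrite (eq_bigr _ (fun b _ => pe m b)) (eq_bigr _ (fun m _ => pe m b)).
Qed.

Lemma cmutinfo_inj (T M B B' : finType) (e : B -> B') (p : T -> M -> B -> R)
    (p' : T -> M -> B' -> R) : injective e ->
  (forall t m b, p' t m (e b) = p t m b) ->
  (forall t m b', (forall b, e b != b') -> p' t m b' = 0) ->
  cmutinfo p' = cmutinfo p.
Proof.
move=> ei pe p0; rewrite !cmutinfoE; congr (_ / _).
apply: eq_bigr => t _; apply: eq_bigr => m _.
have S m' : \sum_b' p' t m' b' = \sum_b p t m' b.
  rewrite (sum_inj_support ei) => [|b' H]; last by rewrite p0.
  by apply: eq_bigr => b _; rewrite pe.
rewrite [LHS](sum_inj_support ei) => [|b' H]; last by rewrite p0// mul0r.
apply: eq_bigr => b _; rewrite pe S.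
by rewrite (eq_bigr _ (fun m _ => S m)) (eq_bigr _ (fun m _ => pe t m b)).
Qed.

End InformationMeasures.

(** * Hybrid outputs, telescoping and time sharing *)

Section Hybrid.
Variables (R : realType) (X S : finType) (n K : nat).
Variables (f : 'I_K -> {ffun 'I_n -> X} -> R) (w1 w2 : X -> S -> R) (d : S).
Hypothesis n0 : (0 < n)%N.
Hypotheses (fP : is_kernel f) (w1P : is_kernel w1) (w2P : is_kernel w2).

Local Notation xT := {ffun 'I_n -> X}.
Local Notation sT := {ffun 'I_n -> S}.

Definition out_law (A : 'I_n -> X -> S -> R) (m : 'I_K) (s : sT) : R :=
  K%:R^-1 * \sum_(x : xT) f m x * \prod_j A j (x j) (s j).

Definition hybrid (k : nat) (j : 'I_n) : X -> S -> R :=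
  if (j < k)%N then w1 else w2.

(* The hybrid channels [hybrid i] and [hybrid i.+1] differ only at coordinate
   [i]; here that coordinate of the output is erased to the fixed symbol [d]. *)
Definition erased (i j : 'I_n) : X -> S -> R :=
  if j == i then fun _ s => (s == d)%:R else hybrid i j.

(* Joint law of the message, the erased output and the [i]-th channel input. *)
Definition erased_law (i : 'I_n) (m : 'I_K) (t : sT) (a : X) : R :=
  K%:R^-1 * \sum_(x : xT | x i == a) f m x * \prod_j erased i j (x j) (t j).

(** Joint law of the erased output, the message and the [i]-th letter received through [w], in the
    order for which [cmutinfo] conditions on the erased output. *)
Definition letter_law (w : X -> S -> R) (i : 'I_n) (t : sT) (m : 'I_K) (c : S) : R :=
  \sum_a erased_law i m t a * w a c.

Definition upd (i : 'I_n) (s : sT) (c : S) : sT :=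
  [ffun j => if j == i then c else s j].

Lemma f_ge0 m x : 0 <= f m x. Proof. by case: (fP m). Qed.

Lemma erased_ge0 i j x s : 0 <= erased i j x s.
Proof.
rewrite /erased /hybrid; case: ifP => // _; case: ifP => _.
  by case: (w1P x).
by case: (w2P x).
Qed.

Lemma erased_sum1 i j x : \sum_s erased i j x s = 1.
Proof.
rewrite /erased /hybrid; case: ifP => _.
  by rewrite (bigD1 d)//= eqxx big1 ?addr0// => s /negbTE ->.
by case: ifP => _; [case: (w1P x)|case: (w2P x)].
Qed.

Lemma erased_law_ge0 i m t a : 0 <= erased_law i m t a.
Proof.
rewrite mulr_ge0 ?invr_ge0// sumr_ge0// => x _.
by rewrite mulr_ge0 ?f_ge0 ?prodr_ge0// => j _; exact: erased_ge0.
Qed.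

Lemma letter_law_ge0 w i t m c : is_kernel w -> 0 <= letter_law w i t m c.
Proof.
by move=> wP; apply: sumr_ge0 => a _; rewrite mulr_ge0 ?erased_law_ge0//; case: (wP a).
Qed.

Lemma letter_law_marginal w i t m : is_kernel w ->
  \sum_c letter_law w i t m c = \sum_a erased_law i m t a.
Proof.
move=> wP; rewrite exchange_big/=; apply: eq_bigr => a _.
by rewrite -mulr_sumr; case: (wP a) => _ ->; rewrite mulr1.
Qed.

(** The chain rule, after the output word is identified with its erasure at [i] together with its
    [i]-th letter. The first summand does not depend on [w], so it cancels between consecutive
    hybrids. *)
Lemma mutinfo_out_law w (A : 'I_n -> X -> S -> R) (i : 'I_n) : is_kernel w -> A i = w ->
  (forall j, j != i -> A j = hybrid i j) ->
  mutinfo (out_law A) =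
  mutinfo (fun m t => \sum_a erased_law i m t a) + cmutinfo (letter_law w i).
Proof.
move=> wP Ai Aj.
have -> : mutinfo (fun m t => \sum_a erased_law i m t a) =
    mutinfo (fun m t => \sum_c letter_law w i t m c).
  by congr mutinfo; apply/funext => m; apply/funext => t; rewrite letter_law_marginal.
rewrite -(@mutinfo_chain _ _ _ _ (fun m t c => letter_law w i t m c)); last first.
  by move=> m t c; exact: letter_law_ge0.
apply/esym/(mutinfo_inj (e := fun s => (upd i s d, s i))).
- move=> s s' [/ffunP E Ei]; apply/ffunP => j; have := E j; rewrite !ffunE.
  by case: eqP => // ->.
- move=> m s /=; rewrite /letter_law /erased_law /out_law.
  rewrite [X in _ = _ * X](partition_big (fun x : xT => x i) xpredT)//= mulr_sumr.
  apply: eq_bigr => a _; rewrite -mulrA mulr_suml; congr (_ * _).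
  apply: eq_bigr => x /eqP xa; rewrite -mulrA; congr (_ * _).
  rewrite (bigD1 i)//= [RHS](bigD1 i)//= /erased ffunE !eqxx mul1r mulrC xa Ai.
  congr (_ * _); apply: eq_bigr => j ji.
  by rewrite ffunE (negbTE ji) Aj.
(* Pairs outside the range of the splitting have a letter other than [d] at coordinate [i], where
   the erased channel has no mass. *)
- move=> m [t c] H /=; apply: big1 => a _.
  have [td|td] := eqVneq (t i) d.
    have /eqP[] := H (upd i t c); congr pair; last by rewrite ffunE eqxx.
    by apply/ffunP => j; rewrite !ffunE; case: eqP => // ->.
  rewrite /erased_law big1 ?mulr0 ?mul0r// => x _.
  by rewrite (bigD1 i)//= /erased eqxx (negbTE td) mul0r mulr0.
Qed.

Lemma mutinfo_telescope :
  mutinfo (out_law (fun=> w1)) - mutinfo (out_law (fun=> w2)) =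
  \sum_(i < n) (cmutinfo (letter_law w1 i) - cmutinfo (letter_law w2 i)).
Proof.
transitivity (\sum_(i < n) (mutinfo (out_law (hybrid i.+1)) - mutinfo (out_law (hybrid i)))).
  rewrite -(big_mkord xpredT (fun i =>
    mutinfo (out_law (hybrid i.+1)) - mutinfo (out_law (hybrid i)))).
  rewrite (telescope_sumr (fun i => mutinfo (out_law (hybrid i))))//.
  congr (mutinfo (out_law _) - mutinfo (out_law _)); apply/funext => j.
  by rewrite /hybrid ltn_ord.
apply: eq_bigr => i _.
rewrite (@mutinfo_out_law w1 _ i)//; last 2 first.
- by rewrite /hybrid ltnSn.
- by move=> j ji; rewrite /hybrid ltnS leq_eqVlt val_eqE (negbTE ji).
rewrite (@mutinfo_out_law w2 (hybrid i) i)//; last by rewrite /hybrid ltnn.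
by rewrite opprD addrACA subrr add0r.
Qed.

Local Notation U := ('I_n * sT)%type.
Local Notation V := (U * 'I_K)%type.

(** Law of [(U, V)] for [U = (i, T_i)], [i] uniform, and [V = (U, M)]. Since [V] contains a copy of
    [U], the input law can depend on [(i, T_i)] and still be a kernel from [V] alone. *)
Definition share_law (u : U) (v : V) : R :=
  if v.1 == u then n%:R^-1 * \sum_a erased_law u.1 v.2 u.2 a else 0.

(** Conditional law of the [i]-th input given [V]; the point mass at [a0] is a default on values of
    [V] without mass. *)
Definition share_kernel (a0 : X) (v : V) (a : X) : R :=
  let N := \sum_a' erased_law v.1.1 v.2 v.1.2 a' in
  if N == 0 then (a == a0)%:R else erased_law v.1.1 v.2 v.1.2 a / N.

Lemma share_lawE a0 u v a : share_law u v * share_kernel a0 v a =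
  if v.1 == u then n%:R^-1 * erased_law u.1 v.2 u.2 a else 0.
Proof.
rewrite /share_law /share_kernel; case: eqP => [<-|_]; last by rewrite mul0r.
case: eqVneq => N0; last by field; rewrite pnatr_eq0 -lt0n n0.
rewrite N0 mulr0 mul0r; apply/esym.
by rewrite (psumr_eq0P (fun a _ => erased_law_ge0 v.1.1 v.2 v.1.2 a) N0 (isT : xpredT a)) mulr0.
Qed.

Lemma share_kernelP a0 : is_kernel (share_kernel a0).
Proof.
move=> v; rewrite /share_kernel; set N := \sum_a' _.
have N0 : 0 <= N by apply: sumr_ge0 => a _; exact: erased_law_ge0.
case: eqVneq => Nz; split.
- by [].
- by rewrite (bigD1 a0)//= eqxx big1 ?addr0// => a /negbTE ->.
- by move=> a; rewrite divr_ge0 ?erased_law_ge0.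
- by rewrite -mulr_suml divff.
Qed.

(** Summing over [t] removes the erased channels, whose rows have mass 1. Taking [c] constant gives
    the total mass, and [c = cost] the expected cost. *)
Lemma share_mean (c : X -> R) :
  \sum_(i < n) \sum_(t : sT) \sum_(m < K) \sum_a n%:R^-1 * erased_law i m t a * c a =
  n%:R^-1 * \sum_(i < n) \sum_(m < K) K%:R^-1 * \sum_(x : xT) f m x * c (x i).
Proof.
rewrite mulr_sumr; apply: eq_bigr => i _.
rewrite exchange_big/= mulr_sumr; apply: eq_bigr => m _.
under eq_bigr => t _.
  rewrite (_ : \sum_a _ = n%:R^-1 * K%:R^-1 *
    \sum_(x : xT) f m x * c (x i) * \prod_j erased i j (x j) (t j)); last first.
    rewrite [X in _ = _ * X](partition_big (fun x : xT => x i) xpredT)//= mulr_sumr.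
    apply: eq_bigr => a _; rewrite /erased_law -!mulrA; congr (_ * (_ * _)).
    by rewrite mulr_suml; apply: eq_bigr => x /eqP ->; ring.
  over.
rewrite -mulr_sumr -mulrA exchange_big/=; congr (_ * (_ * _)).
apply: eq_bigr => x _; rewrite -mulr_sumr -(bigA_distr_bigA (fun j => erased i j (x j))).
by rewrite big1 ?mulr1// => j _; exact: erased_sum1.
Qed.

Lemma sum_share (F : U -> V -> R) : (forall u v, v.1 != u -> F u v = 0) ->
  \sum_u \sum_v F u v = \sum_(i < n) \sum_(t : sT) \sum_(m < K) F (i, t) ((i, t), m).
Proof.
move=> F0; rewrite (pair_bigA _ (fun i t => \sum_(m < K) F (i, t) ((i, t), m)))/=.
apply: eq_bigr => -[i t] _; rewrite sum_pair.
rewrite (bigD1 (i, t))//= [X in _ + X]big1 ?addr0// => u ut.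
by apply: big1 => m _; exact: F0.
Qed.

(** On the support [V] is [M] once [U] is given, and the factor [1/n] occurs twice above and twice
    below the fraction bar inside the logarithm. *)
Lemma cmutinfo_share (H : 'I_n -> sT -> 'I_K -> S -> R) :
  cmutinfo (fun (u : U) (v : V) c =>
    if v.1 == u then n%:R^-1 * H u.1 u.2 v.2 c else 0) =
  n%:R^-1 * \sum_(i < n) cmutinfo (H i).
Proof.
have np : n%:R != 0 :> R by rewrite pnatr_eq0 -lt0n.
have E i t (G : 'I_K -> R) :
    \sum_(v : V) (if v.1 == (i, t) then n%:R^-1 * G v.2 else 0) = n%:R^-1 * \sum_m G m.
  rewrite sum_pair/=.
  rewrite (bigD1 (i, t))//= eqxx mulr_sumr [X in _ + X]big1 ?addr0// => u /negbTE ->.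
  by rewrite big1.
rewrite cmutinfoE (sum_share (F := fun u v => \sum_c _)); last first.
  by move=> u v /negbTE vu; apply: big1 => c _; rewrite vu mul0r.
rewrite mulr_suml mulr_sumr; apply: eq_bigr => i _.
rewrite cmutinfoE mulrA; congr (_ / _); rewrite mulr_sumr; apply: eq_bigr => t _.
rewrite mulr_sumr; apply: eq_bigr => m _; rewrite mulr_sumr; apply: eq_bigr => c _.
rewrite /= eqxx -[LHS]mulrA; congr (_ * (_ * ln _)).
rewrite (E i t (fun m => H i t m c)).
rewrite (eq_bigr (fun v : V => if v.1 == (i, t) then n%:R^-1 *
  \sum_c' H i t v.2 c' else 0)); last first.
  by move=> v _; case: eqP => _; [rewrite mulr_sumr|rewrite big1].
rewrite (E i t (fun m => \sum_c' H i t m c')) -mulr_sumr.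
rewrite [X in X / _ = _]mulrACA [X in _ / X = _]mulrACA -mulf_div.
by rewrite divff ?mul1r// mulf_neq0// invr_eq0.
Qed.

End Hybrid.

(** * Single-letter bound on weakly secret rates *)

Section Converse.
Variables (R : realType) (X Y Z : finType) (W : X -> Y -> Z -> R) (cost : X -> R).
Hypothesis WP : is_channel W.

(** Both channels get the output alphabet [Y + Z], so that a hybrid word may mix letters of the two
    receivers. *)
Definition WYS (x : X) (s : Y + Z) : R := if s is inl y then WY W x y else 0.
Definition WZS (x : X) (s : Y + Z) : R := if s is inr z then WZ W x z else 0.

Lemma WYS_kernel : is_kernel WYS.
Proof.
have WYk := WY_kernel WP; move=> x; split; first by case=> //= y; case: (WYk x).
by rewrite big_sumType/= [X in _ + X]big1 ?addr0 ?(WYk x).2.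
Qed.

Lemma WZS_kernel : is_kernel WZS.
Proof.
have WZk := WZ_kernel WP; move=> x; split; first by case=> //= y; case: (WZk x).
by rewrite big_sumType/= [X in X + _]big1 ?add0r ?(WZk x).2.
Qed.

Lemma inl_ffun_inj n : injective (fun y : {ffun 'I_n -> Y} => [ffun i => inl (y i) : Y + Z]).
Proof. by move=> y y' /ffunP E; apply/ffunP => i; have := E i; rewrite !ffunE => -[]. Qed.

Lemma inr_ffun_inj n : injective (fun z : {ffun 'I_n -> Z} => [ffun i => inr (z i) : Y + Z]).
Proof. by move=> y y' /ffunP E; apply/ffunP => i; have := E i; rewrite !ffunE => -[]. Qed.

Lemma mutinfo_WYn n K (f : 'I_K -> {ffun 'I_n -> X} -> R) :
  mutinfo (out_law f (fun=> WYS)) =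
  mutinfo (fun m y => K%:R^-1 * \sum_x f m x * WYn W x y).
Proof.
apply: (mutinfo_inj (@inl_ffun_inj n)) => [m y|m s H].
  congr (_ * _); apply: eq_bigr => x _; congr (_ * _); apply: eq_bigr => i _.
  by rewrite ffunE.
(* A word outside the range of the embedding has a letter from [Z], to which [WYS] gives no mass. *)
have [i si] : exists i, forall y, s i != inl y.
  apply: contrapT => E.
  have T i : exists y, s i = inl y.
    apply: contrapT => Ei; apply: E; exists i => y; apply/eqP => sy; apply: Ei.
    by exists y.
  have [y yP] := choice T.
  have /eqP[] := H [ffun i => y i].
  by apply/ffunP => i; rewrite !ffunE yP.
rewrite /out_law big1 ?mulr0// => x _; rewrite (bigD1 i)//=.
by case: (s i) si => [y /(_ y)|z _]; rewrite ?eqxx//= mul0r mulr0.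
Qed.

Lemma mutinfo_WZn n K (f : 'I_K -> {ffun 'I_n -> X} -> R) :
  mutinfo (out_law f (fun=> WZS)) =
  mutinfo (fun m z => K%:R^-1 * \sum_x f m x * WZn W x z).
Proof.
apply: (mutinfo_inj (@inr_ffun_inj n)) => [m y|m s H].
  congr (_ * _); apply: eq_bigr => x _; congr (_ * _); apply: eq_bigr => i _.
  by rewrite ffunE.
have [i si] : exists i, forall z, s i != inr z.
  apply: contrapT => E.
  have T i : exists z, s i = inr z.
    apply: contrapT => Ei; apply: E; exists i => z; apply/eqP => sz; apply: Ei.
    by exists z.
  have [z zP] := choice T.
  have /eqP[] := H [ffun i => z i].
  by apply/ffunP => i; rewrite !ffunE zP.
rewrite /out_law big1 ?mulr0// => x _; rewrite (bigD1 i)//=.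
by case: (s i) si => [y _|z /(_ z)]; rewrite ?eqxx//= mul0r mulr0.
Qed.

(** An exact identity for every encoder, by telescoping and time sharing. Reliability and secrecy
    enter only afterwards. *)
Lemma single_letter (x0 : X) (b : R) n K (f : 'I_K -> {ffun 'I_n -> X} -> R) :
  (0 < n)%N -> (0 < K)%N -> valid_code cost b f ->
  exists (U V : finType) (pUV : U -> V -> R) (q : V -> X -> R),
    [/\ is_pmf (fun uv : U * V => pUV uv.1 uv.2), is_kernel q,
        \sum_u \sum_v \sum_x pUV u v * q v x * cost x <= b &
        mutinfo (fun m y => K%:R^-1 * \sum_x f m x * WYn W x y) -
        mutinfo (fun m z => K%:R^-1 * \sum_x f m x * WZn W x z) =
        n%:R * secrecy_value W pUV q].
Proof.
move=> n0 K0 [fP fb].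
(* A channel row has mass 1, so [Y] is inhabited; [y0] supplies the erasure symbol. *)
have [y0 _] : exists y : Y, True.
  case: (pickP (@predT Y)) => [y _|E]; first by exists y.
  by have := (WP x0).2; rewrite big_pred0// => /eqP; rewrite eq_sym oner_eq0.
have nr : n%:R != 0 :> R by rewrite pnatr_eq0 -lt0n.
have Kr : K%:R != 0 :> R by rewrite pnatr_eq0 -lt0n.
pose d : Y + Z := inl y0.
pose G := erased_law f WYS WZS d.
pose sT := {ffun 'I_n -> Y + Z}.
pose U : finType := ('I_n * sT)%type.
pose V : finType := (U * 'I_K)%type.
pose pUV : U -> V -> R := share_law f WYS WZS d.
pose q : V -> X -> R := share_kernel f WYS WZS d x0.
have G0 := erased_law_ge0 d fP WYS_kernel WZS_kernel.
have shE u v a : pUV u v * q v a =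
    if v.1 == u then n%:R^-1 * G u.1 v.2 u.2 a else 0.
  exact: (share_lawE d n0 fP WYS_kernel WZS_kernel).
have qP : is_kernel q := share_kernelP d fP WYS_kernel WZS_kernel x0.
have mean (c : X -> R) : \sum_u \sum_v \sum_x pUV u v * q v x * c x =
    \sum_(m < K) K%:R^-1 * \sum_x f m x * (n%:R^-1 * \sum_(i < n) c (x i)).
  rewrite sum_share; last first.
    by move=> u v /negbTE vu; apply: big1 => x _; rewrite shE vu mul0r.
  transitivity (\sum_(i < n) \sum_(t : sT) \sum_(m < K) \sum_a
      n%:R^-1 * G i m t a * c a).
    apply: eq_bigr => i _; apply: eq_bigr => t _; apply: eq_bigr => m _.
    by apply: eq_bigr => a _; rewrite shE /= eqxx.
  rewrite (share_mean _ _ WYS_kernel WZS_kernel) exchange_big/= mulr_sumr.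
  apply: eq_bigr => m _; rewrite -mulr_sumr mulrCA; congr (_ * _).
  rewrite exchange_big/= mulr_sumr; apply: eq_bigr => x _.
  by rewrite -mulr_sumr mulrCA.
exists U, V, pUV, q; split => //.
- split=> [[u v]/=|].
    rewrite /pUV /share_law; case: eqP => // _.
    by rewrite mulr_ge0 ?invr_ge0 ?sumr_ge0// => a _; exact: G0.
  rewrite sum_pair/=.
  transitivity (\sum_u \sum_v \sum_x pUV u v * q v x * 1).
    apply: eq_bigr => u _; apply: eq_bigr => v _.
    by under eq_bigr do rewrite mulr1; rewrite -mulr_sumr (qP v).2 mulr1.
  rewrite mean (eq_bigr (fun=> K%:R^-1)) => [|m _].
    by rewrite sumr_const card_ord -[LHS]mulr_natr mulVf.
  rewrite sumr_const card_ord mulVf//.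
  by under eq_bigr do rewrite mulr1; rewrite (fP m).2 mulr1.
- rewrite mean; apply: (@le_trans _ _ (\sum_(m < K) K%:R^-1 * b)).
    by apply: ler_sum => m _; rewrite ler_wpM2l ?invr_ge0//; exact: fb.
  by rewrite sumr_const card_ord -[leLHS]mulr_natr mulrAC mulVf// mul1r.
- rewrite -mutinfo_WYn -mutinfo_WZn (mutinfo_telescope d fP WYS_kernel WZS_kernel).
  rewrite sumrB /secrecy_value mulrBr.
  have E (w : X -> Y + Z -> R) :
      cmutinfo (fun (u : U) (v : V) s => \sum_x pUV u v * q v x * w x s) =
      n%:R^-1 * \sum_(i < n) cmutinfo (letter_law f WYS WZS d w i).
    rewrite -cmutinfo_share//; congr cmutinfo.
    apply/funext => u; apply/funext => v; apply/funext => s.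
    under eq_bigr do rewrite shE.
    case: eqP => _; last by apply: big1 => x _; rewrite mul0r.
    by rewrite /letter_law mulr_sumr; apply: eq_bigr => x _; rewrite [RHS]mulrA.
  congr (_ - _).
    rewrite -(@cmutinfo_inj _ _ _ _ _ inl _ (fun u v s => \sum_x pUV u v * q v x * WYS x s))//.
    + by rewrite E mulVKf.
    + by move=> y y' [].
    + move=> u v [y /(_ y)/eqP//|z _].
      by apply: big1 => x _; rewrite mulr0.
  rewrite -(@cmutinfo_inj _ _ _ _ _ inr _ (fun u v s => \sum_x pUV u v * q v x * WZS x s))//.
  + by rewrite E mulVKf.
  + by move=> y y' [].
  + move=> u v [y _|z /(_ z)/eqP//].
    by apply: big1 => x _; rewrite mulr0.
Qed.

(** Fano's inequality bounds the legitimate information below and weak secrecy bounds the leaked one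
    by [e n], so [n Rt <= n value + n e (Rt + 1) + 2]. *)
Lemma weak_rate_bound (x0 : X) (b Rt : R) :
  achievable W cost (@leak_weak R X Y Z W) b Rt -> (Rt%:E <= Cbar W cost b)%E.
Proof.
move=> [Rt0 ach]; apply/lee_addgt0Pr => eta eta0.
(* Chosen so that [e <= 1] and [e (Rt + 1) <= eta/2]; below, [n >= 4/eta] makes the constant 2 at
   most [n eta/2]. *)
set e := eta / (2 * (Rt + 1) + eta).
have D0 : 0 < 2 * (Rt + 1) + eta by lra.
have e0 : 0 < e by rewrite divr_gt0.
have e1 : e <= 1 by rewrite ler_pdivrMr// mul1r; lra.
have eE : e * (2 * (Rt + 1) + eta) = eta by rewrite divfK ?gt_eqF.
have e2 : e * (Rt + 1) <= eta / 2 by nra.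
have [N HN] := ach e e0.
set n := maxn N.+1 (Num.truncn (4 / eta)).+1.
have nN : (N <= n)%N by rewrite (leq_trans (leqnSn N))// leq_maxl.
have n0 : (0 < n)%N by rewrite leq_max.
have np : 0 < n%:R :> R by rewrite ltr0n.
have n4 : 4 <= n%:R * eta.
  rewrite -ler_pdivrMr//; apply: (@le_trans _ _ (Num.truncn (4 / eta)).+1%:R).
    by rewrite ltW// truncnS_gt.
  by rewrite ler_nat leq_maxr.
have [f [g [fv [er lk]]]] := HN n nN.
have K0 := msize_gt0 n Rt0.
have [U [V [pUV [q [pP qP qc E]]]]] := single_letter x0 n0 K0 fv.
apply: (@le_trans _ _ (secrecy_value W pUV q + eta)%:E); last first.
  rewrite EFinD leeD2r//; apply: ereal_sup_ubound; exists (secrecy_value W pUV q) => //.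
  by exists U, V, pUV, q.
have [fP _] := fv.
have wP := kernel_comp fP (kernel_prod (n := n) (WY_kernel WP)).
have we m : \sum_(y | g y != m) \sum_x f m x * WYn W x y <= e.
  apply: le_trans er; rewrite exchange_big/=.
  under eq_bigr do rewrite -mulr_sumr.
  exact: (le_bigmax _ (fun m => \sum_x f m x * \sum_(y | g y != m) WYn W x y)).
have F := mutinfo_fano K0 wP we.
have M := ln_msize_ge n Rt0.
have l2 := ln2_gt0 R.
rewrite lee_fin in lk; rewrite mulrC ler_pdivrMr// in lk.
have {}lk : mutinfo (fun m z => (msize n Rt)%:R^-1 * \sum_x f m x * WZn W x z) <= e * n%:R by [].
rewrite lee_fin.
move: E F; set IY := mutinfo _; set IZ := mutinfo _ in lk *; rewrite -/IY => E F.
have h1 : ln 2 * ((1 - e) * (n%:R * Rt - 1) - 1) <= ln 2 * IY.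
  apply: le_trans F.
  have : (1 - e) * (n%:R * Rt * ln 2 - ln 2) <= (1 - e) * ln (msize n Rt)%:R.
    by rewrite ler_wpM2l// subr_ge0.
  lra.
rewrite ler_pM2l// in h1.
have h2 : n%:R * Rt <= n%:R * (secrecy_value W pUV q + eta).
  have : n%:R * (e * (Rt + 1)) <= n%:R * (eta / 2) by rewrite ler_wpM2l// ltW.
  move=> h3; rewrite [leRHS]mulrDr -E; lra.
by rewrite ler_pM2l in h2.
Qed.

End Converse.

(** * One-shot random coding *)

Lemma prod_if_eq (R : realType) (J : finType) (k : J) (F : J -> R) :
  \prod_j (if j == k then F j else 1) = F k.
Proof. by rewrite -big_mkcond big_pred1_eq. Qed.

Lemma sum_ffun_prod (R : realType) (V J : finType) (F : J -> V -> R) :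
  \sum_(C : {ffun J -> V}) \prod_j F j (C j) = \prod_j \sum_v F j v.
Proof. by rewrite bigA_distr_bigA. Qed.

(** A function of one coordinate is a product over all coordinates with the other factors equal to
    1, so distributivity factors the mean. *)
Lemma prod_law_mean (R : realType) (V J : finType) (p : J -> V -> R) (k : J)
    (phi : V -> R) : (forall j, \sum_v p j v = 1) ->
  \sum_(C : {ffun J -> V}) (\prod_j p j (C j)) * phi (C k) = \sum_v p k v * phi v.
Proof.
move=> p1; under eq_bigr => C _ do
  rewrite -(prod_if_eq k (fun j => phi (C j))) -big_split/=.
rewrite (sum_ffun_prod (fun j v => p j v * (if j == k then phi v else 1))).
rewrite -(prod_if_eq k (fun j => \sum_v p j v * phi v)).
apply: eq_bigr => j _; case: eqP => // _.
by under eq_bigr do rewrite mulr1.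
Qed.

(** * Averages over a codebook of independent words *)

Section Codebook.
Variables (R : realType) (V J : finType) (p : V -> R).
Hypothesis pP : is_pmf p.

Definition code_law (C : {ffun J -> V}) : R := \prod_j p (C j).

Lemma code_law_ge0 C : 0 <= code_law C.
Proof. by apply: prodr_ge0 => j _; case: pP. Qed.

Lemma code_law_sum1 : \sum_C code_law C = 1.
Proof. by rewrite (sum_ffun_prod (fun=> p)) big1// => j _; case: pP. Qed.

Lemma code_mean1 k (phi : V -> R) :
  \sum_C code_law C * phi (C k) = \sum_v p v * phi v.
Proof. by rewrite (@prod_law_mean _ _ _ (fun=> p))// => _; case: pP. Qed.

Lemma code_mean2 k k' (phi psi : V -> R) : k != k' ->
  \sum_C code_law C * (phi (C k) * psi (C k')) =
  (\sum_v p v * phi v) * (\sum_v p v * psi v).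
Proof.
move=> kk'.
under eq_bigr => C _ do
  rewrite -(prod_if_eq k (fun j => phi (C j)))
    -(prod_if_eq k' (fun j => psi (C j))) -!big_split/=.
rewrite (sum_ffun_prod (fun j v => p v *
  ((if j == k then phi v else 1) * (if j == k' then psi v else 1)))).
rewrite -(prod_if_eq k (fun=> \sum_v p v * phi v)).
rewrite -(prod_if_eq k' (fun=> \sum_v p v * psi v)) -big_split/=.
apply: eq_bigr => j _; case: eqP => [->|_].
  by rewrite (negbTE kk') mulr1; apply: eq_bigr => v _; rewrite mulr1.
case: eqP => _; first by rewrite mul1r; apply: eq_bigr => v _; rewrite mul1r.
by under eq_bigr do rewrite !mulr1; rewrite mulr1; case: pP.
Qed.

(* Jensen's inequality for [ln], conditionally on the [k]-th codeword: the
   tangent of [ln] at the conditional mean only involves pairwise products. *)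
Lemma code_mean_ln k (A : {set J}) (N : R) (phi psi al be : V -> R) :
  k \notin A -> #|A|%:R <= N ->
  (forall v, 0 <= phi v) -> (forall v, 0 <= psi v) ->
  (forall v, 0 <= al v) -> (forall v, 0 <= be v) ->
  (forall v, phi v != 0 -> 0 < al v) ->
  \sum_C code_law C *
    (phi (C k) * ln (al (C k) + be (C k) * \sum_(j in A) psi (C j)))
  <= \sum_v p v * (phi v * ln (al v + be v * (N * \sum_v' p v' * psi v'))).
Proof.
move=> kA AN phi0 psi0 al0 be0 alp.
have N0 : 0 <= N by apply: le_trans AN.
set S := \sum_v' p v' * psi v'; have S0 : 0 <= S.
  by apply: sumr_ge0 => v _; rewrite mulr_ge0//; case: pP.
set tau := fun v => al v + be v * (N * S).
have tau0 v : 0 <= tau v by rewrite addr_ge0 ?mulr_ge0.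
have taup v : phi v != 0 -> 0 < tau v.
  by move=> /alp a0; rewrite ltr_wpDr ?mulr_ge0.
(* [g] is [phi] times the slope, in the random sum, of the tangent at [tau]. After averaging, the
   linear part is [(#|A| - N) S] times the mean of [g], hence nonpositive. *)
set g := fun v => phi v * be v / tau v.
have g0 v : 0 <= g v by rewrite divr_ge0 ?mulr_ge0.
have pt C : phi (C k) * ln (al (C k) + be (C k) * \sum_(j in A) psi (C j)) <=
   (phi (C k) * ln (tau (C k)) - N * S * g (C k)) +
   \sum_(j in A) g (C k) * psi (C j).
  have [e|ph] := eqVneq (phi (C k)) 0.
    have -> : g (C k) = 0 by rewrite /g e !mul0r.
    by rewrite e !mul0r mulr0 subrr add0r big1// => j _; rewrite mul0r.
  have t0 := taup _ ph.
  have s0 : 0 <= \sum_(j in A) psi (C j) by apply: sumr_ge0.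
  have a0 : 0 < al (C k) + be (C k) * \sum_(j in A) psi (C j).
    by rewrite ltr_wpDr ?mulr_ge0 ?alp.
  apply: le_trans (ler_wpM2l (phi0 _) (ln_tangent a0 t0)) _.
  rewrite -mulr_sumr /g le_eqVlt; apply/orP; left; apply/eqP.
  rewrite {2}/tau; move: (tau (C k)) t0 => t t0.
  by field; rewrite gt_eqF.
apply: (@le_trans _ _ (\sum_C (code_law C * (phi (C k) * ln (tau (C k)) - N * S * g (C k))
  + \sum_(j in A) code_law C * (g (C k) * psi (C j))))).
  apply: ler_sum => C _; rewrite -mulr_sumr -mulrDr.
  by rewrite ler_wpM2l ?code_law_ge0.
rewrite big_split/= (code_mean1 k (fun v => phi v * ln (tau v) - N * S * g v)).
rewrite exchange_big/=.
have -> : \sum_(j in A) \sum_C code_law C * (g (C k) * psi (C j)) =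
    \sum_(j in A) (\sum_v p v * g v) * S.
  apply: eq_bigr => j jA; rewrite code_mean2//.
  by apply: contraNneq kA => ->.
rewrite sumr_const -mulr_natl.
have -> : \sum_v p v * (phi v * ln (tau v) - N * S * g v) =
   \sum_v p v * (phi v * ln (tau v)) - N * ((\sum_v p v * g v) * S).
  rewrite mulr_suml mulr_sumr -sumrB.
  by apply: eq_bigr => v _; ring.
have G0 : 0 <= (\sum_v p v * g v) * S.
  by rewrite mulr_ge0// sumr_ge0// => v _; rewrite mulr_ge0//; case: pP.
have := ler_wpM2r G0 AN; lra.
Qed.

End Codebook.

(** The outcome is found at positive probability: this later puts every codeword in the support of
    its law, as absolute continuity of the output law requires. *)
Lemma exists_le_mean (R : realType) (I : finType) (P F : I -> R) (c : R) :
  is_pmf P -> \sum_i P i * F i <= c -> exists i, P i != 0 /\ F i <= c.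
Proof.
move=> [P0 P1] le; apply: contrapT => H.
have lt i : P i != 0 -> c < F i.
  by move=> Pi; rewrite ltNge; apply/negP => Fi; apply: H; exists i.
have T i : 0 <= P i * (F i - c).
  have [->|Pi] := eqVneq (P i) 0; first by rewrite mul0r.
  by rewrite mulr_ge0// subr_ge0 ltW ?lt.
have E : \sum_i P i * (F i - c) = 0.
  apply/eqP; rewrite eq_le; apply/andP; split; last exact: sumr_ge0.
  under eq_bigr do rewrite mulrBr.
  by rewrite sumrB -mulr_suml P1 mul1r subr_le0.
have Z i : P i = 0.
  apply: contrapT => /eqP Pi.
  have /eqP := psumr_eq0P (fun i _ => T i) E (isT : xpredT i).
  by rewrite mulf_eq0 (negbTE Pi) subr_eq0 gt_eqF ?lt.
by have := P1; rewrite big1 => [/eqP|i _]; rewrite ?Z// eq_sym oner_eq0.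
Qed.

(** * Error, divergence and expurgation for a random codebook *)

Section OneShot.
Variables (R : realType) (V Y Z : finType) (K L : nat).
Variables (p h : V -> R) (w1 : V -> Y -> R) (w2 : V -> Z -> R).
Variable j0 : 'I_K * 'I_L.
Hypotheses (pP : is_pmf p) (w1P : is_kernel w1) (w2P : is_kernel w2).
Hypothesis h0 : forall v, 0 <= h v.

Local Notation J := ('I_K * 'I_L)%type.
Local Notation Q1 y := (\sum_v p v * w1 v y).
Local Notation Q2 z := (\sum_v p v * w2 v z).

Definition ml_decoder (C : {ffun J -> V}) (y : Y) : 'I_K :=
  [arg max_(j > j0) w1 (C j) y]%O.1.

Definition code_err (C : {ffun J -> V}) (m : 'I_K) : R :=
  L%:R^-1 * \sum_(l < L) \sum_(y | ml_decoder C y != m) w1 (C (m, l)) y.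

Definition code_out (C : {ffun J -> V}) (m : 'I_K) (z : Z) : R :=
  L%:R^-1 * \sum_(l < L) w2 (C (m, l)) z.

Definition code_div (C : {ffun J -> V}) (m : 'I_K) : R :=
  \sum_z code_out C m z * ln (code_out C m z / Q2 z).

Definition code_cost (C : {ffun J -> V}) (m : 'I_K) : R :=
  L%:R^-1 * \sum_(l < L) h (C (m, l)).

Lemma L_gt0 : 0 < L%:R :> R.
Proof. by rewrite ltr0n; case: L j0 => [[_ []]|]. Qed.

Lemma mean_avg_le (F : {ffun J -> V} -> 'I_L -> R) (c : R) :
  (forall l, \sum_C code_law p C * F C l <= c) ->
  \sum_C code_law p C * (L%:R^-1 * \sum_(l < L) F C l) <= c.
Proof.
move=> H; under eq_bigr do rewrite mulrCA mulr_sumr.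
rewrite -mulr_sumr exchange_big/= mulrC ler_pdivrMr ?L_gt0//.
apply: le_trans (ler_sum _ (fun l _ => H l)) _.
by rewrite sumr_const card_ord mulr_natr.
Qed.

Lemma mean_code_cost m :
  \sum_C code_law p C * code_cost C m <= \sum_v p v * h v.
Proof. by apply: mean_avg_le => l; rewrite code_mean1. Qed.

(** When decoding fails, some other word is at least as likely as the sent one, so the sum of
    likelihood ratios over the other words is at least 1. The error indicator is therefore at most
    [log2] of 1 plus that sum, and [code_mean_ln] averages this. *)
Lemma mean_code_err m : \sum_C code_law p C * code_err C m <=
  (\sum_v \sum_y p v * w1 v y * ln (1 + (K * L)%:R * (Q1 y / w1 v y))) / ln 2.
Proof.
apply: mean_avg_le => l; rewrite ler_pdivlMr ?ln2_gt0//.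
have w10 v y : 0 <= w1 v y by case: (w1P v).
pose k := (m, l).
have pt C : (\sum_(y | ml_decoder C y != m) w1 (C k) y) * ln 2 <=
   \sum_y w1 (C k) y * ln (1 + (w1 (C k) y)^-1 * \sum_(j in [set~ k]) w1 (C j) y).
  rewrite mulr_suml [leRHS](bigID (fun y => ml_decoder C y != m))/=.
  have S0 y : 0 <= (w1 (C k) y)^-1 * \sum_(j in [set~ k]) w1 (C j) y.
    by rewrite mulr_ge0 ?invr_ge0 ?sumr_ge0.
  rewrite -[leLHS]addr0 lerD//; last first.
    by apply: sumr_ge0 => y _; rewrite mulr_ge0// ln_ge0// lerDl.
  apply: ler_sum => y; rewrite /ml_decoder; case: arg_maxP => // j _ jmax jm.
  have [->|wk] := eqVneq (w1 (C k) y) 0; first by rewrite !mul0r.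
  have wp : 0 < w1 (C k) y by rewrite lt_neqAle eq_sym wk w10.
  rewrite ler_wpM2l// ler_ln ?posrE ?ltr_wpDr//.
  suff : 1 <= (w1 (C k) y)^-1 * \sum_(j in [set~ k]) w1 (C j) y by lra.
  rewrite mulrC ler_pdivlMr// mul1r.
  rewrite (bigD1 j)/=; last by rewrite !inE; apply: contraNneq jm => ->.
  by rewrite ler_wpDr ?sumr_ge0//; exact: jmax.
rewrite mulr_suml.
apply: le_trans (_ : \sum_C \sum_y code_law p C * (w1 (C k) y *
   ln (1 + (w1 (C k) y)^-1 * \sum_(j in [set~ k]) w1 (C j) y)) <= _).
  apply: ler_sum => C _; rewrite -mulrA -mulr_sumr ler_wpM2l ?code_law_ge0//.
rewrite exchange_big/= [leRHS]exchange_big/=; apply: ler_sum => y _.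
apply: le_trans (code_mean_ln pP (k := k) (A := [set~ k]) (N := (K * L)%:R)
  (phi := w1^~ y) (psi := w1^~ y) (al := fun=> 1) (be := fun v => (w1 v y)^-1)
  _ _ _ _ _ _ _) _ => //.
- by rewrite !inE eqxx.
- by rewrite ler_nat (leq_trans (max_card _))// card_prod !card_ord.
- by move=> v; rewrite invr_ge0.
- apply: ler_sum => v _; rewrite mulrA.
  by rewrite (_ : _^-1 * _ = (K * L)%:R * (Q1 y / w1 v y))//; ring.
Qed.

(** In the mixture over [l], the word that weights the logarithm is singled out as [al]; by
    [code_mean_ln] the other words of the message contribute at most 1 to the normalised mean. *)
Lemma mean_code_div m : \sum_C code_law p C * code_div C m <=
  \sum_v \sum_z p v * w2 v z * ln (1 + L%:R^-1 * (w2 v z / Q2 z)).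
Proof.
have w20 v y : 0 <= w2 v y by case: (w2P v).
have p0 v : 0 <= p v by case: pP.
have L0 := L_gt0.
have Q0 z : 0 <= Q2 z by apply: sumr_ge0 => v _; rewrite mulr_ge0.
have E C : code_div C m = L%:R^-1 * \sum_(l < L) \sum_z w2 (C (m, l)) z *
    ln (code_out C m z / Q2 z).
  by rewrite /code_div exchange_big/= mulr_sumr; apply: eq_bigr => z _;
    rewrite {1}/code_out -mulrA mulr_suml.
under eq_bigr do rewrite E.
apply: mean_avg_le => l; pose k := (m, l).
pose A := [set j : J | (j.1 == m) && (j.2 != l)].
under eq_bigr do rewrite mulr_sumr.
rewrite exchange_big/= [leRHS]exchange_big/=; apply: ler_sum => z _.
(* Here division by zero gives 0 and [ln 0 = 0], so the left side vanishes. *)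
have [Qz|Qz] := eqVneq (Q2 z) 0.
  rewrite big1 => [|C _]; last by rewrite Qz invr0 mulr0 ln0 ?mulr0.
  by apply: sumr_ge0 => v _; rewrite Qz invr0 !mulr0 addr0 ln1 mulr0.
have Qp : 0 < Q2 z by rewrite lt_neqAle eq_sym Qz Q0.
have EC C : code_out C m z / Q2 z =
  w2 (C k) z / (L%:R * Q2 z) + (L%:R * Q2 z)^-1 * \sum_(j in A) w2 (C j) z.
  rewrite /code_out (bigD1 l)//= (_ : \sum_(i < L | _) _ = \sum_(j in A) w2 (C j) z).
    by field; rewrite !gt_eqF.
  rewrite (reindex_onto (fun i => (m, i)) (fun j : J => j.2))/=.
    by apply: eq_bigl => i; rewrite !inE/= !eqxx andbT.
  by case=> a b; rewrite !inE/= => /andP[/eqP ->].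
under eq_bigr do rewrite EC.
apply: le_trans (code_mean_ln pP (k := k) (A := A) (N := L%:R)
  (phi := w2^~ z) (psi := w2^~ z) (al := fun v => w2 v z / (L%:R * Q2 z))
  (be := fun=> (L%:R * Q2 z)^-1)  _ _ _ _ _ _ _) _ => //.
- by rewrite !inE eqxx/= eqxx.
- have AE : A \subset [set (m, i) | i : 'I_L].
    apply/fintype.subsetP => -[a b]; rewrite !inE/= => /andP[/eqP-> _].
    by apply/imsetP; exists b.
  rewrite ler_nat (leq_trans (subset_leq_card AE))//.
  by rewrite (leq_trans (leq_imset_card _ _))// card_ord.
- by move=> v; rewrite divr_ge0 ?mulr_ge0// ltW.
- by move=> v; rewrite invr_ge0 mulr_ge0// ltW.
- by move=> v wv; rewrite divr_gt0 ?mulr_gt0// lt_neqAle eq_sym wv w20.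
- apply: ler_sum => v _; rewrite mulrA.
  rewrite (_ : w2 v z / _ + _ = 1 + L%:R^-1 * (w2 v z / Q2 z))//.
  by field; rewrite !gt_eqF.
Qed.

(* The hypothesis bounds the mean over messages of the score
   cost + err / e1 + div / e2 by 1 - eta; a message of score at most 1 is good. *)
Theorem random_code (e1 e2 eta : R) : 0 < e1 -> 0 < e2 ->
  \sum_v p v * h v +
  (\sum_v \sum_y p v * w1 v y * ln (1 + (K * L)%:R * (Q1 y / w1 v y))) / ln 2 / e1 +
  (\sum_v \sum_z p v * w2 v z * ln (1 + L%:R^-1 * (w2 v z / Q2 z))) / e2
    <= 1 - eta ->
  exists2 C : {ffun J -> V}, forall j, p (C j) != 0 &
  exists2 G : {set 'I_K}, eta * K%:R <= #|G|%:R &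
  forall m, m \in G ->
    [/\ code_cost C m <= 1, code_err C m <= e1 & code_div C m <= e2].
Proof.
move=> e10 e20 le.
pose sc C m := code_cost C m + code_err C m / e1 + code_div C m / e2.
have [|C [pC sC]] := @exists_le_mean R _ (code_law p) (fun C => \sum_m sc C m)
  ((1 - eta) * K%:R) (conj (code_law_ge0 pP) (code_law_sum1 _ pP)).
  under eq_bigr do rewrite mulr_sumr.
  rewrite exchange_big/=.
  apply: (@le_trans _ _ (\sum_(m < K) (1 - eta))); last first.
    by rewrite sumr_const card_ord mulr_natr.
  apply: ler_sum => m _; apply: le_trans le.
  rewrite (eq_bigr (fun C => code_law p C * code_cost C m +
    code_law p C * code_err C m / e1 + code_law p C * code_div C m / e2)); last first.
    by move=> C _; rewrite /sc !mulrDr !mulrA.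
  rewrite !big_split/= -(mulr_suml _ _ _ e1^-1) -(mulr_suml _ _ _ e2^-1).
  apply: lerD; [apply: lerD; [exact: mean_code_cost|]|].
    by rewrite ler_pM2r ?invr_gt0// mean_code_err.
  by rewrite ler_pM2r ?invr_gt0// mean_code_div.
have pCj j : p (C j) != 0.
  by apply: contraNneq pC => pj; rewrite /code_law (bigD1 j)//= pj mul0r.
exists C => //.
have w10 v y : 0 <= w1 v y by case: (w1P v).
have w20 v z : 0 <= w2 v z by case: (w2P v).
have p0 v : 0 <= p v by case: pP.
have L0 := L_gt0.
have LV : 0 <= L%:R^-1 :> R by rewrite invr_ge0 ltW.
have c0 m : 0 <= code_cost C m by rewrite mulr_ge0 ?sumr_ge0.
have er0 m : 0 <= code_err C m.
  by rewrite mulr_ge0// sumr_ge0// => l _; rewrite sumr_ge0.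
have o0 m z : 0 <= code_out C m z by rewrite mulr_ge0// sumr_ge0.
(* Each summand of the score must be nonnegative for the score to bound all three. *)
have d0 m : 0 <= code_div C m.
  apply: gibbs => // [z|z|].
  - by apply: sumr_ge0 => v _; rewrite mulr_ge0.
  - apply: contra_neq => /(psumr_eq0P (fun v _ => mulr_ge0 (p0 v) (w20 v z))) Q0.
    rewrite /code_out big1 ?mulr0// => l _.
    have /eqP := Q0 (C (m, l)) isT.
    by rewrite mulf_eq0 (negbTE (pCj _)) => /eqP.
  - suff -> : \sum_z code_out C m z = 1.
      rewrite exchange_big/= (eq_bigr p) => [|v _]; first by case: pP => _ ->.
      by rewrite -mulr_sumr; case: (w2P v) => _ ->; rewrite mulr1.
    rewrite /code_out -mulr_sumr exchange_big/=.
    rewrite (eq_bigr (fun=> 1)) => [|l _]; last by case: (w2P (C (m, l))).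
    by rewrite sumr_const card_ord mulVf ?gt_eqF.
have s0 m : 0 <= sc C m by rewrite !addr_ge0 ?divr_ge0// ltW.
(* Markov's inequality: every message left out has score above 1, so at most [(1 - eta) K] are left
   out. *)
exists [set m | sc C m <= 1].
  have : \sum_(m in ~: [set m | sc C m <= 1]) 1 <= \sum_m sc C m.
    rewrite [leRHS](bigID (fun m => m \in ~: [set m | sc C m <= 1]))/= ler_wpDr ?sumr_ge0//.
    by apply: ler_sum => m; rewrite !inE -ltNge => /ltW.
  rewrite sumr_const => h1; have := le_trans h1 sC.
  have : #|[set m | sc C m <= 1]|%:R + #|~: [set m | sc C m <= 1]|%:R = K%:R :> R.
    by rewrite -natrD cardsC card_ord.
  move: #|_|%:R #|_|%:R => a b; lra.
move=> m; rewrite inE => sm.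
have t1 : 0 <= code_err C m / e1 by rewrite divr_ge0// ltW.
have t2 : 0 <= code_div C m / e2 by rewrite divr_ge0// ltW.
have := c0 m; rewrite /sc in sm; split.
- lra.
- by rewrite -[e1]mul1r -ler_pdivrMr//; lra.
- by rewrite -[e2]mul1r -ler_pdivrMr//; lra.
Qed.

End OneShot.

(** * Codes from codebooks *)

Section WiretapCode.
Variable R : realType.

(* [Q] does not depend on the message law [PM], which is what makes the bound
   usable for semantic security. *)
Lemma mutinfo_le_div (M Z : finType) (PM : M -> R) (P : M -> Z -> R) (Q : Z -> R)
    (e : R) :
  is_pmf PM -> is_kernel P -> is_pmf Q -> (forall m z, P m z != 0 -> Q z != 0) ->
  (forall m, \sum_z P m z * ln (P m z / Q z) <= e) ->
  mutinfo (fun m z => PM m * P m z) <= e / ln 2.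
Proof.
move=> [PM0 PM1] PP [Q0 Q1] PQ De.
have P0 m z : 0 <= P m z by case: (PP m).
rewrite mutinfoE ler_pM2r ?invr_gt0 ?ln2_gt0//.
apply: (@le_trans _ _ (\sum_m PM m * \sum_z P m z * ln (P m z / Q z))); last first.
  apply: (@le_trans _ _ (\sum_m PM m * e)); last by rewrite -mulr_suml PM1 mul1r.
  by apply: ler_sum => m _; rewrite ler_wpM2l.
set PZ := fun z => \sum_m PM m * P m z.
have PZ0 z : 0 <= PZ z by apply: sumr_ge0 => m _; rewrite mulr_ge0.
have PZn m z : PM m != 0 -> P m z != 0 -> 0 < PZ z.
  move=> pm pz; rewrite lt_neqAle eq_sym PZ0 andbT; apply/negP => /eqP.
  move/(psumr_eq0P (fun m _ => mulr_ge0 (PM0 m) (P0 m z))) => /(_ m isT)/eqP.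
  by rewrite mulf_eq0 (negbTE pm) (negbTE pz).
(* The mean divergence to [Q] is the mutual information plus the divergence of the output law [PZ]
   from [Q]; the latter is nonnegative. *)
have : 0 <= \sum_z PZ z * ln (PZ z / Q z).
  apply: gibbs => // [z|].
    apply: contra_neq => Qz; rewrite /PZ big1// => m _.
    have [->|/PQ] := eqVneq (P m z) 0; first by rewrite mulr0.
    by rewrite Qz eqxx.
  rewrite Q1 exchange_big/= (eq_bigr PM) ?PM1// => m _.
  by rewrite -mulr_sumr (PP m).2 mulr1.
under eq_bigr do rewrite mulr_suml.
rewrite exchange_big/= => G; rewrite -[leLHS]addr0; apply: le_trans (lerD (lexx _) G) _.
rewrite -big_split/= le_eqVlt; apply/orP; left; apply/eqP; apply: eq_bigr => m _.
rewrite -big_split/= mulr_sumr; apply: eq_bigr => z _; rewrite -mulrDr -/(PZ z).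
have [->|pm] := eqVneq (PM m) 0; first by rewrite !mul0r.
have [->|pz] := eqVneq (P m z) 0; first by rewrite mulr0 !mul0r mulr0.
have z0 := PZn m z pm pz.
have q0 : 0 < Q z by rewrite lt_neqAle eq_sym (PQ m)/=.
have m0 : 0 < PM m by rewrite lt_neqAle eq_sym pm/=.
have p0 : 0 < P m z by rewrite lt_neqAle eq_sym pz/=.
rewrite -mulr_sumr (PP m).2 mulr1 -lnM ?posrE ?divr_gt0 ?mulr_gt0// -[LHS]mulrA.
by congr (_ * (_ * ln _)); field; rewrite !gt_eqF.
Qed.

Variables (X Y Z : finType) (W : X -> Y -> Z -> R) (cost : X -> R).
Hypothesis WP : is_channel W.

Definition prefix_Y (V : finType) (q : V -> X -> R) (v : V) (y : Y) : R :=
  \sum_x q v x * WY W x y.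
Definition prefix_Z (V : finType) (q : V -> X -> R) (v : V) (z : Z) : R :=
  \sum_x q v x * WZ W x z.

Section FromCodebook.
Variables (V : finType) (n K K' L : nat).
Variables (p : {ffun 'I_n -> V} -> R) (q : V -> X -> R) (h : V -> R) (b be : R).
Hypotheses (n0 : (0 < n)%N) (K0 : (0 < K)%N) (K'0 : (0 < K')%N) (L0 : (0 < L)%N).
Hypotheses (pP : is_pmf p) (qP : is_kernel q) (h0 : forall v, 0 <= h v).
Hypothesis be0 : 0 <= be.
Hypothesis hcost : forall v, \sum_x q v x * cost x <= b + be * (h v - 1).

Definition ext_Y (v : {ffun 'I_n -> V}) (y : {ffun 'I_n -> Y}) : R :=
  \prod_i prefix_Y q (v i) (y i).
Definition ext_Z (v : {ffun 'I_n -> V}) (z : {ffun 'I_n -> Z}) : R :=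
  \prod_i prefix_Z q (v i) (z i).
Definition ext_h (v : {ffun 'I_n -> V}) : R := n%:R^-1 * \sum_i h (v i).
Definition ext_X (v : {ffun 'I_n -> V}) (x : {ffun 'I_n -> X}) : R :=
  \prod_i q (v i) (x i).

Lemma ext_X_WYn v y : \sum_x ext_X v x * WYn W x y = ext_Y v y.
Proof.
under eq_bigr do rewrite -big_split/=.
by rewrite -(bigA_distr_bigA (fun i x => q (v i) x * WY W x (y i))).
Qed.

Lemma ext_X_WZn v z : \sum_x ext_X v x * WZn W x z = ext_Z v z.
Proof.
under eq_bigr do rewrite -big_split/=.
by rewrite -(bigA_distr_bigA (fun i x => q (v i) x * WZ W x (z i))).
Qed.

Lemma ext_X_kernel : is_kernel ext_X.
Proof. exact: kernel_prod. Qed.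

Lemma ext_X_cost v : \sum_x ext_X v x * costn cost x <= b + be * (ext_h v - 1).
Proof.
have np : 0 < n%:R :> R by rewrite ltr0n.
have -> : \sum_x ext_X v x * costn cost x =
    n%:R^-1 * \sum_(i < n) \sum_x q (v i) x * cost x.
  under eq_bigr do rewrite /costn mulrCA mulr_sumr.
  rewrite -mulr_sumr exchange_big/=; congr (_ * _); apply: eq_bigr => i _.
  by rewrite (prod_law_mean (p := fun i x => q (v i) x))// => j; case: (qP (v j)).
have -> : b + be * (ext_h v - 1) = n%:R^-1 * \sum_(i < n) (b + be * (h (v i) - 1)).
  rewrite big_split/= -mulr_sumr sumrB !sumr_const !card_ord /ext_h.
  by rewrite -[b *+ n]mulr_natr; field; rewrite gt_eqF.
by rewrite ler_pM2l ?invr_gt0// ler_sum.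
Qed.

(** A codebook for [K'] messages is drawn, and [K] of the good ones are kept and renumbered by [io].
    The encoder picks [l] uniformly and sends the chosen word through the prefix channel [q]. *)
Lemma wiretap_code (e1 e2 eta : R) : 0 < e1 -> 0 < e2 -> K%:R <= eta * K'%:R ->
  \sum_v p v * ext_h v +
  (\sum_v \sum_y p v * ext_Y v y *
     ln (1 + (K' * L)%:R * ((\sum_v' p v' * ext_Y v' y) / ext_Y v y))) / ln 2 / e1 +
  (\sum_v \sum_z p v * ext_Z v z *
     ln (1 + L%:R^-1 * (ext_Z v z / (\sum_v' p v' * ext_Z v' z)))) / e2
    <= 1 - eta ->
  exists (f : 'I_K -> {ffun 'I_n -> X} -> R) (g : {ffun 'I_n -> Y} -> 'I_K),
    [/\ valid_code cost b f, max_err W f g <= e1 &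
        (leak_sem W f <= (e2 / ln 2)%:E)%E].
Proof.
move=> e10 e20 Keta.
have YP : is_kernel ext_Y by apply: kernel_prod; apply: kernel_comp => //; exact: WY_kernel.
have ZP : is_kernel ext_Z by apply: kernel_prod; apply: kernel_comp => //; exact: WZ_kernel.
have XP := ext_X_kernel.
have H0 v : 0 <= ext_h v by rewrite mulr_ge0 ?invr_ge0 ?sumr_ge0.
have Lp : 0 < L%:R :> R by rewrite ltr0n.
pose j0 := (Ordinal K'0, Ordinal L0).
move=> /(random_code j0 pP YP ZP H0 e10 e20) [C pC [G Gc GP]].
have KG : (K <= #|G|)%N by rewrite -(ler_nat R) (le_trans Keta).
pose io (m : 'I_K) : 'I_K' := enum_val (widen_ord KG m).
have ioG m : io m \in G := enum_valP _.
have io_inj : injective io by move=> m m' /enum_val_inj /(congr1 val)/= /val_inj.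
pose f (m : 'I_K) x := L%:R^-1 * \sum_(l < L) ext_X (C (io m, l)) x.
(* The default serves outputs decoded to a discarded message; [g] errs only where the
   maximum-likelihood decoder already does. *)
pose g y : 'I_K := odflt (Ordinal K0) [pick m | io m == ml_decoder ext_Y j0 C y].
have fE (T : finType) (w : {ffun 'I_n -> X} -> T -> R) m t :
    \sum_x f m x * w x t = L%:R^-1 * \sum_(l < L) \sum_x ext_X (C (io m, l)) x * w x t.
  rewrite exchange_big/= mulr_sumr; apply: eq_bigr => x _.
  by rewrite -mulrA mulr_suml.
have fP : is_kernel f.
  move=> m; split=> [x|].
    by rewrite mulr_ge0 ?invr_ge0 ?(ltW Lp)// sumr_ge0// => l _; case: (XP (C (io m, l))).
  have := fE unit (fun _ _ => 1) m tt; under eq_bigr do rewrite mulr1.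
  move=> ->; rewrite (eq_bigr (fun=> 1)) => [|l _].
    by rewrite sumr_const card_ord mulVf ?gt_eqF.
  by under eq_bigr do rewrite mulr1; case: (XP (C (io m, l))).
have fZ m z : \sum_x f m x * WZn W x z = code_out ext_Z C (io m) z.
  by rewrite fE; congr (_ * _); apply: eq_bigr => l _; rewrite ext_X_WZn.
exists f, g; split.
- split=> // m.
  rewrite (fE unit (fun x _ => costn cost x) m tt).
  have [cm _ _] := GP _ (ioG m).
  (* A good message has [code_cost] at most 1, which makes this bound at most [b]. *)
  apply: (@le_trans _ _ (b + be * (code_cost ext_h C (io m) - 1))).
    have -> : b + be * (code_cost ext_h C (io m) - 1) =
        L%:R^-1 * \sum_(l < L) (b + be * (ext_h (C (io m, l)) - 1)).
      rewrite big_split/= -mulr_sumr sumrB !sumr_const !card_ord /code_cost.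
      by rewrite -[b *+ L]mulr_natr; field; rewrite gt_eqF.
    by rewrite ler_pM2l ?invr_gt0// ler_sum// => l _; exact: ext_X_cost.
  by rewrite gerDl mulr_ge0_le0// subr_le0.
- apply: bigmax_le => [|m _]; first exact: ltW.
  have [_ em _] := GP _ (ioG m); apply: le_trans em.
  rewrite (fE unit (fun x _ => \sum_(y | g y != m) WYn W x y) m tt).
  rewrite ler_pM2l ?invr_gt0//; apply: ler_sum => l _.
  have -> : \sum_x ext_X (C (io m, l)) x * (\sum_(y | g y != m) WYn W x y) =
      \sum_(y | g y != m) ext_Y (C (io m, l)) y.
    under eq_bigr do rewrite mulr_sumr.
    by rewrite exchange_big/=; apply: eq_bigr => y _; rewrite ext_X_WYn.
  rewrite [leLHS]big_mkcond [leRHS]big_mkcond; apply: ler_sum => y _.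
  case: ifPn => gm; last by case: ifP => // _; case: (YP (C (io m, l))).
  rewrite ifT//; apply: contraNneq gm => dm; rewrite /g.
  case: pickP => [m'|/(_ m)]; last by rewrite dm eqxx.
  by rewrite dm /= => /eqP /io_inj ->.
- apply: ge_ereal_sup => _ [PM PMP <-]; rewrite lee_fin.
  apply: (mutinfo_le_div (Q := fun z => \sum_v p v * ext_Z v z)) => //.
  + by apply: kernel_comp => //; apply: kernel_prod; exact: WZ_kernel.
  + exact: (kernel_comp (p := fun _ : unit => p) (fun=> pP) ZP tt).
  + move=> m z; rewrite fZ; apply: contra_neq => Q0; rewrite /code_out big1 ?mulr0// => l _.
    have nn v : 0 <= p v * ext_Z v z by rewrite mulr_ge0//; [case: pP|case: (ZP v)].
    have /eqP := psumr_eq0P (fun v _ => nn v) Q0 (isT : xpredT (C (io m, l))).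
    by rewrite mulf_eq0 (negbTE (pC _)) => /eqP.
  + move=> m; have [_ _ dm] := GP _ (ioG m); apply: le_trans dm.
    by rewrite /code_div; under eq_bigr do rewrite fZ.
Qed.

End FromCodebook.
End WiretapCode.

(** * Achievability *)

Section Memoryless.
Variable R : realType.

Lemma iid_sum (U V S : finType) n (F : U -> V -> S -> R) :
  \sum_(u : {ffun 'I_n -> U}) \sum_(v : {ffun 'I_n -> V}) \sum_(s : {ffun 'I_n -> S})
    \prod_i F (u i) (v i) (s i) = (\sum_u \sum_v \sum_s F u v s) ^+ n.
Proof.
under eq_bigr => u _.
  under eq_bigr => v _ do rewrite -(bigA_distr_bigA (fun i s => F (u i) (v i) s)).
  rewrite -(bigA_distr_bigA (fun i v => \sum_s F (u i) v s)).
  over.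
rewrite -(bigA_distr_bigA (fun i u => \sum_v \sum_s F u v s)).
by rewrite prodr_const card_ord.
Qed.

(** By [ln1D_le_powR] the mean is at most [c^s/s] times the [n]-th power of a one-letter moment. One
    [d] pays for [moment_bound]; the other leaves [exp (- n s d) / s]. *)
Lemma iid_ln1D (U V S : finType) (P r : U -> V -> S -> R) (d eps : R) :
  (forall u v s, 0 <= P u v s) -> \sum_u \sum_v \sum_s P u v s = 1 ->
  (forall u v s, 0 <= r u v s) -> (forall u v s, P u v s != 0 -> 0 < r u v s) ->
  0 < d -> 0 < eps ->
  exists N, forall n, (N <= n)%N -> forall c, 0 < c ->
    ln c <= - (n%:R * (\sum_u \sum_v \sum_s P u v s * ln (r u v s) + 2 * d)) ->
    \sum_(u : {ffun 'I_n -> U}) \sum_(v : {ffun 'I_n -> V}) \sum_(s : {ffun 'I_n -> S})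
      (\prod_i P (u i) (v i) (s i)) * ln (1 + c * \prod_i r (u i) (v i) (s i)) <= eps.
Proof.
move=> P0 P1 r0 rp d0 eps0.
pose T : finType := (U * V * S)%type.
have TE (F : U -> V -> S -> R) : \sum_(t : T) F t.1.1 t.1.2 t.2 = \sum_u \sum_v \sum_s F u v s.
  by rewrite sum_pair/= sum_pair.
have [] := @moment_bound R T (fun t => P t.1.1 t.1.2 t.2) (fun t => r t.1.1 t.1.2 t.2) d => //.
- by split => [t|]; [exact: P0|rewrite (TE P)].
- by move=> t; exact: rp.
move=> s [s0 s1]; rewrite (TE (fun u v x => P u v x * r u v x `^ s))
  (TE (fun u v x => P u v x * ln (r u v x))).
set M := \sum_u _; set E := \sum_u _ => HM.
(* Then [exp (n s d) >= n s d >= 1 / (s eps)], uniformly in [c]. *)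
exists (Num.truncn (s * s * d * eps)^-1).+1 => n nN c c0 lc.
have np : 0 < n%:R :> R by rewrite ltr0n (leq_trans _ nN).
apply: (@le_trans _ _ (c `^ s / s * M ^+ n)).
  rewrite /M -iid_sum mulr_sumr; apply: ler_sum => u _.
  rewrite mulr_sumr; apply: ler_sum => v _; rewrite mulr_sumr; apply: ler_sum => x _.
  have pr0 : 0 <= \prod_i r (u i) (v i) (x i) by apply: prodr_ge0.
  have := @ln1D_le_powR R s (c * \prod_i r (u i) (v i) (x i)) s0 s1.
  rewrite mulr_ge0 ?(ltW c0)// => /(_ isT) h.
  rewrite big_split/= mulrCA; apply: ler_wpM2l; first exact: prodr_ge0.
  apply: le_trans h _; rewrite powRM ?(ltW c0)// powR_prod//.
  by rewrite mulrAC.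
have M0 : 0 <= M.
  by do 3! apply: sumr_ge0 => ? _; rewrite mulr_ge0 ?powR_ge0.
apply: (@le_trans _ _ (c `^ s / s * expR (s * (E + d)) ^+ n)).
  apply: ler_wpM2l; first by rewrite divr_ge0 ?powR_ge0// ltW.
  by rewrite lerXn2r ?nnegrE ?expR_ge0.
rewrite -expRM_natl /powR (gt_eqF c0) mulrAC -expRD ler_pdivrMr//.
apply: (@le_trans _ _ (expR (- (n%:R * (s * d))))).
  rewrite ler_expR.
  have : s * ln c <= s * (- (n%:R * (E + 2 * d))) by rewrite ler_wpM2l// ltW.
  lra.
rewrite expRN -[leRHS]invrK lef_pV2 ?posrE ?expR_gt0 ?invr_gt0 ?mulr_gt0//.
apply: le_trans _ (expR_ge1Dx _).
apply: (@le_trans _ _ (n%:R * (s * d))); last by rewrite lerDr.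
have h : (s * s * d * eps)^-1 <= n%:R.
  apply: (@le_trans _ _ (Num.truncn (s * s * d * eps)^-1).+1%:R); last by rewrite ler_nat.
  by rewrite ltW// truncnS_gt.
have := ler_wpM2r (ltW (mulr_gt0 s0 d0)) h; apply: le_trans.
rewrite le_eqVlt; apply/orP; left; apply/eqP; field; rewrite !gt_eqF//.
Qed.

(** [I(V;S|U)] in nats, in the likelihood-ratio form of the random coding bounds. *)
Definition cond_info (U V S : finType) (pU : U -> R) (k : U -> V -> R) (w : V -> S -> R) : R :=
  \sum_u \sum_v \sum_s pU u * k u v * w v s * ln (w v s / \sum_v' k u v' * w v' s).

Lemma cond_info_ge0 (U V S : finType) (pU : U -> R) (k : U -> V -> R) (w : V -> S -> R) :
  (forall u, 0 <= pU u) -> is_kernel k -> is_kernel w -> 0 <= cond_info pU k w.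
Proof.
move=> pU0 kP wP; apply: sumr_ge0 => u _.
have k0 v : 0 <= k u v by case: (kP u).
have w0 v s : 0 <= w v s by case: (wP v).
set Q := fun s => \sum_v' k u v' * w v' s.
have Q0 s : 0 <= Q s by apply: sumr_ge0 => v _; rewrite mulr_ge0.
have Qn v s : k u v * w v s != 0 -> Q s != 0.
  move=> kw; apply: contra_neq kw => /(psumr_eq0P (fun v _ => mulr_ge0 (k0 v) (w0 v s))).
  exact.
have Q1 : \sum_s Q s = 1.
  rewrite exchange_big/= -[RHS](kP u).2; apply: eq_bigr => v _.
  by rewrite -mulr_sumr (wP v).2 mulr1.
have -> : \sum_v \sum_s pU u * k u v * w v s * ln (w v s / Q s) =
  pU u * \sum_(a : V * S) k u a.1 * w a.1 a.2 *
    ln (k u a.1 * w a.1 a.2 / (k u a.1 * Q a.2)).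
  rewrite sum_pair/= mulr_sumr; apply: eq_bigr => v _; rewrite mulr_sumr.
  apply: eq_bigr => s _; rewrite -!mulrA.
  have [->|kv] := eqVneq (k u v) 0; first by rewrite !mul0r.
  by rewrite invfM [w v s * (_^-1 * _)]mulrCA mulVKf.
rewrite mulr_ge0// gibbs//= => [a|a|[v s]/= kw|].
- by rewrite mulr_ge0.
- by rewrite mulr_ge0.
- rewrite mulf_neq0 ?(Qn v)//.
  by apply: contra_neq kw => ->; rewrite mul0r.
- rewrite !sum_pair/= exchange_big/= [leRHS]exchange_big/=.
  by rewrite (eq_bigr Q) ?Q1// => s _; rewrite -mulr_suml (kP u).2 mul1r.
Qed.

Lemma cmutinfo_prefix (U V X S : finType) (pU : U -> R) (k : U -> V -> R)
    (q : V -> X -> R) (w : X -> S -> R) :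
  (forall u, 0 <= pU u) -> is_kernel k -> is_kernel q -> is_kernel w ->
  cmutinfo (fun u v s => \sum_x pU u * k u v * q v x * w x s) =
  cond_info pU k (fun v s => \sum_x q v x * w x s) / ln 2.
Proof.
move=> pU0 kP qP wP; have := kernel_comp qP wP; set g := fun v s => \sum_x _ => gP.
have E u v s : \sum_x pU u * k u v * q v x * w x s = pU u * k u v * g v s.
  by rewrite mulr_sumr; apply: eq_bigr => x _; rewrite mulrA.
rewrite cmutinfoE; congr (_ / _); apply: eq_bigr => u _; apply: eq_bigr => v _.
apply: eq_bigr => s _; rewrite E.
have SE v' : \sum_c' \sum_x pU u * k u v' * q v' x * w x c' = pU u * k u v'.
  by under eq_bigr do rewrite E; rewrite -mulr_sumr (gP v').2 mulr1.
rewrite SE (eq_bigr _ (fun v' _ => SE v')) (eq_bigr _ (fun v' _ => E u v' s)).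
rewrite -mulr_sumr (kP u).2 mulr1.
have [->|pu] := eqVneq (pU u) 0; first by rewrite !mul0r.
have [->|kv] := eqVneq (k u v) 0; first by rewrite !(mulr0, mul0r).
congr (_ * ln _).
under [X in _ / (_ * X)]eq_bigr do rewrite -mulrA.
rewrite -mulr_sumr !invfM; set Q := \sum_v' _.
move: (Q^-1) => z; field.
by rewrite pu kv.
Qed.

End Memoryless.

(** * Rates below the information difference *)

Section Achievability.
Variables (R : realType) (X Y Z : finType) (W : X -> Y -> Z -> R) (cost : X -> R).
Hypothesis WP : is_channel W.

Lemma prefix_Y_kernel (V : finType) (q : V -> X -> R) :
  is_kernel q -> is_kernel (prefix_Y W q).
Proof. by move=> qP; apply: kernel_comp => //; exact: WY_kernel. Qed.

Lemma prefix_Z_kernel (V : finType) (q : V -> X -> R) :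
  is_kernel q -> is_kernel (prefix_Z W q).
Proof. by move=> qP; apply: kernel_comp => //; exact: WZ_kernel. Qed.

Section Core.
Variables (U V : finType) (pU : U -> R) (k : U -> V -> R).
Hypotheses (pUP : is_pmf pU) (kP : is_kernel k).

Definition rows n (u : {ffun 'I_n -> U}) (v : {ffun 'I_n -> V}) : R :=
  \prod_i k (u i) (v i).

Lemma rows_pmf n (u : {ffun 'I_n -> U}) : is_pmf (rows u).
Proof. exact: kernel_prod. Qed.

Lemma rows_output (S : finType) (w : V -> S -> R) n (u : {ffun 'I_n -> U})
    (s : {ffun 'I_n -> S}) :
  \sum_v rows u v * (\prod_i w (v i) (s i)) =
  \prod_i \sum_v k (u i) v * w v (s i).
Proof.
under [LHS]eq_bigr do rewrite -big_split/=.
by rewrite -(bigA_distr_bigA (fun i v => k (u i) v * w v (s i))).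
Qed.

Lemma mean_rows_h n (h : V -> R) : (0 < n)%N ->
  \sum_(u : {ffun 'I_n -> U}) (\prod_i pU (u i)) * (\sum_v rows u v * ext_h h v) =
  \sum_u \sum_v pU u * k u v * h v.
Proof.
move=> n0; have np : n%:R != 0 :> R by rewrite pnatr_eq0 -lt0n.
have E (u : {ffun 'I_n -> U}) : \sum_v rows u v * ext_h h v =
    n%:R^-1 * \sum_i \sum_v k (u i) v * h v.
  under eq_bigr do rewrite /ext_h mulrCA mulr_sumr.
  rewrite -mulr_sumr exchange_big/=; congr (_ * _); apply: eq_bigr => i _.
  by rewrite (prod_law_mean (p := fun i v => k (u i) v))// => j; case: (kP (u j)).
under eq_bigr do rewrite E mulrCA mulr_sumr.
rewrite -mulr_sumr exchange_big/=.
rewrite (eq_bigr (fun=> \sum_u \sum_v pU u * k u v * h v)) => [|i _].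
  by rewrite sumr_const card_ord -[X in _ * X]mulr_natl mulKf.
rewrite (prod_law_mean (p := fun=> pU) i (fun u => \sum_v k u v * h v)); last first.
  by move=> _; case: pUP.
by apply: eq_bigr => u _; rewrite mulr_sumr; apply: eq_bigr => v _; rewrite mulrA.
Qed.

Section Letter.
Variables (S : finType) (w : V -> S -> R).
Hypothesis wP : is_kernel w.
Let Q u s := \sum_v k u v * w v s.

Let k0 u v : 0 <= k u v. Proof. by case: (kP u). Qed.
Let w0 v s : 0 <= w v s. Proof. by case: (wP v). Qed.
Let Q0 u s : 0 <= Q u s. Proof. by apply: sumr_ge0 => v _; rewrite mulr_ge0. Qed.
Let law u v s : R := pU u * k u v * w v s.

Let law_ge0 u v s : 0 <= law u v s.
Proof. by rewrite !mulr_ge0//; case: pUP. Qed.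

Let law_sum1 : \sum_u \sum_v \sum_s law u v s = 1.
Proof.
rewrite -pUP.2; apply: eq_bigr => u _.
under eq_bigr do rewrite -mulr_sumr (wP _).2 mulr1.
by rewrite -mulr_sumr (kP u).2 mulr1.
Qed.

Let law_pos u v s : law u v s != 0 -> 0 < w v s /\ 0 < Q u s.
Proof.
rewrite /law !mulf_eq0 !negb_or => /andP[/andP[_ kv] wv].
split; rewrite lt_neqAle eq_sym ?wv ?w0// Q0 andbT.
apply/negP => /eqP/(psumr_eq0P (fun v _ => mulr_ge0 (k0 u v) (w0 v s)))/(_ v isT)/eqP.
by rewrite mulf_eq0 (negbTE kv) (negbTE wv).
Qed.

Let regroup n (F : {ffun 'I_n -> U} -> {ffun 'I_n -> V} -> {ffun 'I_n -> S} -> R) :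
  \sum_(u : {ffun 'I_n -> U}) (\prod_i pU (u i)) *
    (\sum_v \sum_(s : {ffun 'I_n -> S}) rows u v * (\prod_i w (v i) (s i)) * F u v s) =
  \sum_(u : {ffun 'I_n -> U}) \sum_(v : {ffun 'I_n -> V}) \sum_(s : {ffun 'I_n -> S})
    (\prod_i law (u i) (v i) (s i)) * F u v s.
Proof.
apply: eq_bigr => u _; rewrite mulr_sumr; apply: eq_bigr => v _.
rewrite mulr_sumr; apply: eq_bigr => s _; rewrite !mulrA; congr (_ * _).
by rewrite /law !big_split/=.
Qed.

(** [iid_ln1D] for the ratio [Q/w], whose mean logarithm is minus the conditional information; [c]
    will be the codebook size. *)
Lemma mean_confusion (d eps : R) : 0 < d -> 0 < eps ->
  exists N, forall n, (N <= n)%N -> forall c, 0 < c ->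
    ln c <= n%:R * (cond_info pU k w - 2 * d) ->
    \sum_(u : {ffun 'I_n -> U}) (\prod_i pU (u i)) *
      (\sum_v \sum_(s : {ffun 'I_n -> S}) rows u v * (\prod_i w (v i) (s i)) *
        ln (1 + c * ((\sum_v' rows u v' * (\prod_i w (v' i) (s i))) /
                     \prod_i w (v i) (s i)))) <= eps.
Proof.
move=> d0 eps0.
have [||N HN] := @iid_ln1D R U V S law (fun u v s => Q u s / w v s) d eps
  law_ge0 law_sum1 _ _ d0 eps0.
- by move=> u v s; rewrite divr_ge0.
- by move=> u v s /law_pos[? ?]; rewrite divr_gt0.
exists N => n nN c c0 lc; rewrite regroup.
apply: le_trans (HN n nN c c0 _).
  apply: ler_sum => u _; apply: ler_sum => v _; apply: ler_sum => s _.
  by rewrite rows_output prodf_div.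
have -> : \sum_u \sum_v \sum_s law u v s * ln (Q u s / w v s) = - cond_info pU k w.
  rewrite -sumrN; apply: eq_bigr => u _; rewrite -sumrN; apply: eq_bigr => v _.
  rewrite -sumrN; apply: eq_bigr => s _; rewrite -/(law u v s) -/(Q u s).
  have [->|/law_pos[wv Qu]] := eqVneq (law u v s) 0; first by rewrite !mul0r oppr0.
  by rewrite -invf_div lnV ?posrE ?divr_gt0// mulrN.
apply: le_trans lc _; move: (cond_info pU k w) => I0; lra.
Qed.

(** The reciprocal ratio [w/Q]; [c] will be [1/L], so [L] must exceed the exponential of the leaked
    information. *)
Lemma mean_resolvability (d eps : R) : 0 < d -> 0 < eps ->
  exists N, forall n, (N <= n)%N -> forall c, 0 < c ->
    ln c <= - (n%:R * (cond_info pU k w + 2 * d)) ->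
    \sum_(u : {ffun 'I_n -> U}) (\prod_i pU (u i)) *
      (\sum_v \sum_(s : {ffun 'I_n -> S}) rows u v * (\prod_i w (v i) (s i)) *
        ln (1 + c * ((\prod_i w (v i) (s i)) /
                     (\sum_v' rows u v' * (\prod_i w (v' i) (s i)))))) <= eps.
Proof.
move=> d0 eps0.
have [||N HN] := @iid_ln1D R U V S law (fun u v s => w v s / Q u s) d eps
  law_ge0 law_sum1 _ _ d0 eps0.
- by move=> u v s; rewrite divr_ge0.
- by move=> u v s /law_pos[? ?]; rewrite divr_gt0.
exists N => n nN c c0 lc; rewrite regroup.
apply: le_trans (HN n nN c c0 lc).
apply: ler_sum => u _; apply: ler_sum => v _; apply: ler_sum => s _.
by rewrite rows_output prodf_div.
Qed.

End Letter.

(* The affine domination of the cost by [h] serves two cases at once: [h] is the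
   cost divided by [b] when the budget is slack, and [h = 0] when [b] is the
   minimal cost. *)
Lemma achievable_prefix (q : V -> X -> R) (h : V -> R) (b be Rt : R) :
  is_kernel q -> (forall v, 0 <= h v) -> 0 <= be ->
  (forall v, \sum_x q v x * cost x <= b + be * (h v - 1)) ->
  \sum_u \sum_v pU u * k u v * h v < 1 ->
  0 <= Rt ->
  Rt * ln 2 < cond_info pU k (prefix_Y W q) - cond_info pU k (prefix_Z W q) ->
  achievable W cost (@leak_sem R X Y Z W) b Rt.
Proof.
move=> qP h0 be0 hc Eh Rt0 Rt1; split=> // eps eps0.
have YP := prefix_Y_kernel qP; have ZP := prefix_Z_kernel qP.
have IZ0 := cond_info_ge0 pUP.1 kP ZP.
set IY := cond_info pU k (prefix_Y W q) in Rt1 *.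
set IZ := cond_info pU k (prefix_Z W q) in Rt1 IZ0 *.
(* Two shares go to the confusion margin, two to the resolvability margin, and the fifth covers
   [ln N0 + ln 2] for large [n]. *)
set d := (IY - IZ - Rt * ln 2) / 5.
have d0 : 0 < d by rewrite divr_gt0//; lra.
set Mh := \sum_u _ in Eh.
have Mh0 : 0 < 1 - Mh by lra.
(* The slack [1 - Mh] holds three portions [1/N0]: error, divergence, and the fraction of messages
   that survives expurgation. Hence [N0 * K] messages are drawn. *)
set N0 := (Num.truncn (3 / (1 - Mh))).+1.
have N0p : 0 < N0%:R :> R by rewrite ltr0n.
have N0h : Mh <= 1 - 3 / N0%:R.
  have : 3 / (1 - Mh) <= N0%:R by rewrite ltW// truncnS_gt.
  rewrite ler_pdivrMr// mulrC -ler_pdivrMr//; lra.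
have l2 := ln2_gt0 R.
have N0V : 0 < N0%:R^-1 :> R by rewrite invr_gt0.
have [N1 HN1] := mean_confusion YP d0 (mulr_gt0 (mulr_gt0 N0V l2) eps0).
have [N2 HN2] := mean_resolvability ZP d0 (mulr_gt0 N0V (mulr_gt0 eps0 l2)).
rewrite -/IY in HN1; rewrite -/IZ in HN2.
set N3 := (Num.truncn ((ln N0%:R + ln 2) / d)).+1.
exists (maxn N1 (maxn N2 N3)) => n; rewrite !geq_max => /andP[n1 /andP[n2 n3]].
have n0 : (0 < n)%N by apply: leq_trans n3.
have np : 0 < n%:R :> R by rewrite ltr0n.
have nd : ln N0%:R + ln 2 <= n%:R * d.
  rewrite -ler_pdivrMr//; apply: (@le_trans _ _ N3%:R); last by rewrite ler_nat.
  by rewrite ltW// truncnS_gt.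
set K := msize n Rt; have K0 : (0 < K)%N := msize_gt0 n Rt0.
have Kp : 0 < K%:R :> R by rewrite ltr0n.
set x := n%:R * (IZ + 2 * d).
have x0 : 0 <= x by rewrite mulr_ge0 ?ltW//; lra.
(* Rounding up keeps [L >= exp x]; as [x >= 0], also [L <= 2 exp x]. *)
set L := (Num.truncn (expR x)).+1.
have Lp : 0 < L%:R :> R by rewrite ltr0n.
have Lx : expR x <= L%:R by rewrite ltW// truncnS_gt.
have L2 : L%:R <= 2 * expR x.
  have /andP[h1 _] := truncn_itv (expR_ge0 x).
  have := @expR_ge1Dx R x; rewrite /L -natr1; lra.
have lnL : - ln L%:R <= - x by rewrite lerN2 -[x]expRK ler_ln ?posrE ?expR_gt0.
have lnL2 : ln L%:R <= ln 2 + x.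
  by rewrite -[x]expRK -lnM ?posrE ?expR_gt0// ler_ln ?posrE ?mulr_gt0 ?expR_gt0.
have lnK : ln K%:R <= n%:R * Rt * ln 2.
  by rewrite -[leRHS]expRK ler_ln ?posrE ?expR_gt0//; exact: msize_le.
have {}HN2 := HN2 n n2 L%:R^-1 _ _.
have {}HN1 := HN1 n n1 (N0 * K * L)%:R _ _.
have pPU : is_pmf (fun u : {ffun 'I_n -> U} => \prod_i pU (u i)).
  by split; [exact: code_law_ge0|exact: code_law_sum1].
pose A (u : {ffun 'I_n -> U}) := \sum_v rows u v * ext_h h v.
pose B (u : {ffun 'I_n -> U}) := \sum_v \sum_(y : {ffun 'I_n -> Y}) rows u v * ext_Y W q v y *
  ln (1 + (N0 * K * L)%:R * ((\sum_v' rows u v' * ext_Y W q v' y) / ext_Y W q v y)).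
pose D (u : {ffun 'I_n -> U}) := \sum_v \sum_(z : {ffun 'I_n -> Z}) rows u v * ext_Z W q v z *
  ln (1 + L%:R^-1 * (ext_Z W q v z / \sum_v' rows u v' * ext_Z W q v' z)).
(* The bounds hold on average over [u^n]; one sequence meeting the total is fixed for the code. *)
have [|u [_ uB]] := @exists_le_mean R _ _ (fun u => A u + B u / ln 2 / eps + D u / (eps * ln 2))
  (1 - N0%:R^-1) pPU.
  under eq_bigr do rewrite !mulrDr !mulrA.
  rewrite !big_split/= -!mulr_suml mean_rows_h// -/Mh.
  have hB : (\sum_(u : {ffun 'I_n -> U}) (\prod_i pU (u i)) * B u) / ln 2 / eps <= N0%:R^-1.
    rewrite ler_pdivrMr// ler_pdivrMr//.
    rewrite mulrAC; apply: HN1; first by rewrite ltr0n !muln_gt0 K0.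
    rewrite !natrM !lnM ?posrE ?mulr_gt0//.
    have : n%:R * (IY - 2 * d) = n%:R * Rt * ln 2 + x + n%:R * d.
      by rewrite /x /d; field.
    lra.
  have hD : (\sum_(u : {ffun 'I_n -> U}) (\prod_i pU (u i)) * D u) / (eps * ln 2) <= N0%:R^-1.
    rewrite ler_pdivrMr ?mulr_gt0//; apply: HN2; first by rewrite invr_gt0.
    by rewrite lnV ?posrE.
  have e3 : 3 / N0%:R = N0%:R^-1 + N0%:R^-1 + N0%:R^-1 :> R by ring.
  rewrite invfM !mulrA in hD *; lra.
have NK0 : (0 < N0 * K)%N by rewrite muln_gt0.
have L0 : (0 < L)%N by [].
have KN : K%:R <= N0%:R^-1 * (N0 * K)%:R :> R by rewrite natrM mulKf// gt_eqF.
have [f [g [fv fe fl]]] := wiretap_code WP n0 K0 NK0 L0 (rows_pmf u) qP h0 be0 hc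
  eps0 (mulr_gt0 eps0 l2) KN uB.
by exists f, g; split; last split => //; move: fl; rewrite mulfK ?gt_eqF.
Qed.

End Core.
End Achievability.

(** * Cost slack, rate zero and comparison of the capacities *)

Section Capacity.
Variables (R : realType) (X Y Z : finType) (W : X -> Y -> Z -> R) (cost : X -> R).
Hypothesis WP : is_channel W.

Lemma pmf_point (A : finType) (a : A) : is_pmf (fun a' => (a' == a)%:R : R).
Proof.
split=> [a'|]; first exact: ler0n.
by rewrite (bigD1 a)//= eqxx big1 ?addr0// => a' /negbTE ->.
Qed.

Lemma sum_point (A : finType) (a : A) (F : A -> R) : \sum_a' (a' == a)%:R * F a' = F a.
Proof.
rewrite (bigD1 a)//= eqxx mul1r big1 ?addr0// => a' /negbTE ->.
by rewrite mul0r.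
Qed.

Lemma disintegration (U V : finType) (pUV : U -> V -> R) :
  is_pmf (fun uv : U * V => pUV uv.1 uv.2) ->
  exists (pU : U -> R) (k : U -> V -> R),
    [/\ is_pmf pU, is_kernel k & forall u v, pUV u v = pU u * k u v].
Proof.
move=> [p0 p1].
have P0 u v : 0 <= pUV u v by exact: (p0 (u, v)).
have [v0 _] : exists v : V, True.
  case: (pickP (@predT (U * V))) => [[_ v] _|E]; first by exists v.
  by move/eqP: p1; rewrite big_pred0// eq_sym oner_eq0.
exists (fun u => \sum_v pUV u v).
exists (fun u v => if \sum_v pUV u v == 0 then (v == v0)%:R else pUV u v / \sum_v pUV u v).
split; first by split=> [u|]; [exact: sumr_ge0|rewrite -p1 sum_pair].
- move=> u; case: eqVneq => Su; first exact: pmf_point.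
  split=> [v|]; first by rewrite divr_ge0 ?sumr_ge0.
  by rewrite -mulr_suml divff.
- move=> u v; case: eqVneq => Su; last by rewrite mulrCA divff// mulr1.
  by rewrite Su mul0r; exact: (psumr_eq0P (fun v _ => P0 u v) Su).
Qed.

Lemma secrecy_valueE (U V : finType) (pUV : U -> V -> R) (pU : U -> R)
    (k : U -> V -> R) (q : V -> X -> R) :
  is_pmf pU -> is_kernel k -> is_kernel q -> (forall u v, pUV u v = pU u * k u v) ->
  secrecy_value W pUV q * ln 2 =
  cond_info pU k (prefix_Y W q) - cond_info pU k (prefix_Z W q).
Proof.
move=> pUP kP qP pE.
have -> : pUV = fun u v => pU u * k u v.
  by apply/funext => u; apply/funext => v; exact: pE.
rewrite /secrecy_value mulrBl.
rewrite (cmutinfo_prefix pUP.1 kP qP (WY_kernel WP)).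
rewrite (cmutinfo_prefix pUP.1 kP qP (WZ_kernel WP)).
by rewrite !divfK ?gt_eqF ?ln2_gt0.
Qed.

Section Mixing.
Variables (U V : finType) (pU : U -> R) (k : U -> V -> R) (q : V -> X -> R).
Variables (la : R) (xm : X).
Hypotheses (la0 : 0 <= la) (la1 : la <= 1).
Hypotheses (pUP : is_pmf pU) (kP : is_kernel k) (qP : is_kernel q).

(** Time sharing with a cheapest letter: with probability [la] a new symbol of [U] forces the new
    symbol of [V] and the input [xm]. That branch carries no information. *)
Definition mix_law (u : U + unit) : R := if u is inl u then (1 - la) * pU u else la.
Definition mix_kernel (u : U + unit) (v : V + unit) : R :=
  match u, v with
  | inl u, inl v => k u v
  | inr _, inr _ => 1
  | _, _ => 0
  end.
Definition mix_prefix (v : V + unit) (x : X) : R :=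
  if v is inl v then q v x else (x == xm)%:R.

Lemma sum_unit (F : unit -> R) : \sum_t F t = F tt.
Proof. by rewrite (big_pred1 tt)// => -[]. Qed.

Lemma mix_law_pmf : is_pmf mix_law.
Proof.
split=> [[u|_]//=|]; first by rewrite mulr_ge0 ?subr_ge0//; case: pUP.
by rewrite big_sumType/= sum_unit -mulr_sumr pUP.2 mulr1 subrK.
Qed.

Lemma mix_kernelP : is_kernel mix_kernel.
Proof.
case=> [u|t]; (split=> [[v|s]//=|]; rewrite ?big_sumType/= ?sum_unit).
- by case: (kP u).
- by rewrite addr0 (kP u).2.
- by rewrite big1 ?add0r.
Qed.

Lemma mix_prefixP : is_kernel mix_prefix.
Proof. by case=> [v|t]; [exact: qP|exact: pmf_point]. Qed.

Lemma cond_info_mix (S : finType) (w : X -> S -> R) : is_kernel w ->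
  cond_info mix_law mix_kernel (fun v s => \sum_x mix_prefix v x * w x s) =
  (1 - la) * cond_info pU k (fun v s => \sum_x q v x * w x s).
Proof.
move=> wP; rewrite /cond_info big_sumType/= sum_unit [X in _ + X](_ : _ = 0) ?addr0.
  rewrite mulr_sumr; apply: eq_bigr => u _; rewrite big_sumType/= sum_unit.
  rewrite [X in _ + X]big1 ?addr0 => [|s _]; last by rewrite mulr0 !mul0r.
  rewrite mulr_sumr; apply: eq_bigr => v _.
  rewrite mulr_sumr; apply: eq_bigr => s _.
  by rewrite big_sumType/= sum_unit mul0r addr0 !mulrA.
rewrite big_sumType/= sum_unit big1 ?add0r => [|v _]; last first.
  by apply: big1 => s _; rewrite mulr0 !mul0r.
apply: big1 => s _; rewrite big_sumType/= sum_unit [X in X + _]big1 ?add0r => [|v _]; last first.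
  by rewrite mul0r.
rewrite mul1r sum_point; have [->|ws] := eqVneq (w xm s) 0; first by rewrite mulr0 mul0r.
by rewrite divff// ln1 mulr0.
Qed.

Lemma mix_mean (c : V + unit -> R) :
  \sum_u \sum_v mix_law u * mix_kernel u v * c v =
  (1 - la) * (\sum_u \sum_v pU u * k u v * c (inl v)) + la * c (inr tt).
Proof.
rewrite big_sumType/= sum_unit; congr (_ + _).
  rewrite mulr_sumr; apply: eq_bigr => u _; rewrite big_sumType/= sum_unit mulr0 mul0r addr0.
  by rewrite mulr_sumr; apply: eq_bigr => v _; rewrite !mulrA.
rewrite big_sumType/= sum_unit big1 ?add0r ?mulr1// => v _.
by rewrite mulr0 mul0r.
Qed.

End Mixing.

Lemma achievable_secrecy_value (xm : X) (b Rt : R) (U V : finType)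
    (pUV : U -> V -> R) (q : V -> X -> R) :
  (forall x, 0 <= cost x) -> (forall x, cost xm <= cost x) -> cost xm <= b ->
  is_pmf (fun uv : U * V => pUV uv.1 uv.2) -> is_kernel q ->
  \sum_u \sum_v \sum_x pUV u v * q v x * cost x <= b ->
  0 <= Rt -> Rt < secrecy_value W pUV q ->
  achievable W cost (@leak_sem R X Y Z W) b Rt.
Proof.
move=> cost0 costm mb pP qP qb Rt0 Rtr.
have l2 := ln2_gt0 R.
have [pU [k [pUP kP pE]]] := disintegration pP.
have k0 u v : 0 <= k u v by case: (kP u).
have pU0 u : 0 <= pU u by case: pUP.
pose c v := \sum_x q v x * cost x.
have c0 v : 0 <= c v by apply: sumr_ge0 => x _; rewrite mulr_ge0//; case: (qP v).
have Ec : \sum_u \sum_v pU u * k u v * c v <= b.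
  apply: le_trans qb; rewrite le_eqVlt; apply/orP; left; apply/eqP.
  apply: eq_bigr => u _; apply: eq_bigr => v _; rewrite mulr_sumr.
  by apply: eq_bigr => x _; rewrite pE mulrA.
have [mb1|mb1] := ltP (cost xm) b.
  have b0 : 0 < b by apply: le_lt_trans mb1.
  set r := secrecy_value W pUV q in Rtr.
  have r0 : 0 < r by lra.
  (* Mixing gives up half of the gap [r - Rt], so [(1 - la) r] still exceeds [Rt], while the mean
     cost drops strictly below [b]. *)
  pose la := (r - Rt) / (2 * r).
  have la0 : 0 < la by rewrite divr_gt0 ?mulr_gt0// subr_gt0.
  have laE : la * r = (r - Rt) / 2 by rewrite /la; field; rewrite gt_eqF.
  have la1 : la <= 1 by rewrite ler_pdivrMr ?mulr_gt0//; lra.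
  pose q' := mix_prefix q xm.
  pose h v := (\sum_x q' v x * cost x) / b.
  apply: (@achievable_prefix R X Y Z W cost WP _ _ (mix_law pU la) (mix_kernel k)
    (mix_law_pmf (ltW la0) la1 pUP) (mix_kernelP kP) q' h b b) => //.
  - exact: mix_prefixP.
  - move=> v; rewrite divr_ge0 ?(ltW b0)// sumr_ge0// => x _.
    by rewrite mulr_ge0//; case: (mix_prefixP xm qP v).
  - exact: ltW.
  - by move=> v; rewrite /h mulrBr mulr1 mulrCA divff ?gt_eqF// mulr1; lra.
  - rewrite mix_mean /h /= sum_point.
    under eq_bigr do under eq_bigr do rewrite mulrA.
    under eq_bigr do rewrite -mulr_suml.
    rewrite -mulr_suml !mulrA -mulrDl ltr_pdivrMr// mul1r -/(c _).
    have : (1 - la) * (\sum_u \sum_v pU u * k u v * c v) <= (1 - la) * b.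
      by rewrite ler_wpM2l// subr_ge0.
    have : la * cost xm < la * b by rewrite ltr_pM2l.
    rewrite /c; lra.
  - rewrite (cond_info_mix pU k q la xm (WY_kernel WP)).
    rewrite (cond_info_mix pU k q la xm (WZ_kernel WP)).
    rewrite -mulrBr -[X in _ < _ * X](secrecy_valueE pUP kP qP pE) mulrA ltr_pM2r//.
    rewrite -/r; lra.
(* Now [b] is the minimal cost, so [c >= b] everywhere with mean at most [b]. Symbols with [c v > b]
   have no mass, and redirecting them to [xm] leaves the joint law unchanged. *)
pose q' v := if c v <= b then q v else fun x => (x == xm)%:R.
have q'P : is_kernel q' by move=> v; rewrite /q'; case: ifP => _; [exact: qP|exact: pmf_point].
have bc v : b <= c v.
  rewrite -[b]mul1r -(qP v).2 mulr_suml; apply: ler_sum => x _.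
  by rewrite ler_wpM2l//; [case: (qP v)|exact: le_trans (costm x)].
have p1 : \sum_u \sum_v pU u * k u v = 1.
  by under eq_bigr do rewrite -mulr_sumr (kP _).2 mulr1; case: pUP.
have T0 u v : 0 <= pU u * k u v * (c v - b) by rewrite !mulr_ge0 ?subr_ge0.
have S0 : \sum_(a : U * V) pU a.1 * k a.1 a.2 * (c a.2 - b) = 0.
  apply/eqP; rewrite eq_le sumr_ge0 ?andbT// sum_pair/=.
  under eq_bigr do under eq_bigr do rewrite mulrBr.
  under eq_bigr do rewrite sumrB -mulr_suml.
  by rewrite sumrB -mulr_suml p1 mul1r subr_le0.
have qq' u v x : pUV u v * q' v x = pUV u v * q v x.
  rewrite /q'; case: ifPn => //; rewrite -ltNge => cb.
  have /eqP := psumr_eq0P (fun a _ => T0 a.1 a.2) S0 (isT : xpredT (u, v)).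
  by rewrite /= mulf_eq0 subr_eq0 (gt_eqF cb) orbF -pE => /eqP ->; rewrite !mul0r.
have sv : secrecy_value W pUV q' = secrecy_value W pUV q.
  rewrite /secrecy_value/=; congr (_ - _); congr cmutinfo;
    apply/funext => u; apply/funext => v; apply/funext => s;
    by apply: eq_bigr => x _; rewrite qq'.
apply: (@achievable_prefix R X Y Z W cost WP _ _ pU k pUP kP q' (fun=> 0) b 0) => //.
- move=> v; rewrite mul0r addr0 /q'; case: ifPn => [//|_].
  by rewrite sum_point.
- by rewrite big1 ?ltr01// => u _; apply: big1 => v _; rewrite mulr0.
- by rewrite -(secrecy_valueE pUP kP q'P pE) ltr_pM2r// sv.
Qed.

(** At rate 0 there is a single message, sent as a constant word. This handles targets in the
    supremum that are negative. *)
Lemma achievable_zero (xm : X) (b : R) : cost xm <= b ->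
  achievable W cost (@leak_sem R X Y Z W) b 0.
Proof.
move=> mb; split=> // eps eps0; exists 1%N => n n1.
have K1 (m m' : 'I_(msize n (0 : R))) : m = m'.
  apply: val_inj; case: m => m mK; case: m' => m' mK' /=.
  have E : msize n (0 : R) = 1%N.
    by rewrite /msize mulr0 powRr0; apply: truncn_def; rewrite lexx ltr1n.
  by move: mK mK'; rewrite E !ltnS !leqn0 => /eqP -> /eqP ->.
pose c : {ffun 'I_n -> X} := [ffun=> xm].
pose m0 := Ordinal (msize_gt0 n (lexx (0 : R))).
exists (fun _ x => (x == c)%:R), (fun=> m0); split; [split|split].
- by move=> m; exact: pmf_point.
- move=> m; rewrite sum_point /costn.
  under eq_bigr do rewrite ffunE.
  by rewrite sumr_const card_ord -[X in _ * X]mulr_natl mulKf// pnatr_eq0 -lt0n.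
- apply: bigmax_le => [|m _]; first exact: ltW.
  by rewrite sum_point big_pred0 ?ltW// => y; rewrite (K1 m0 m) eqxx.
- apply: ge_ereal_sup => _ [PM PMP <-]; rewrite lee_fin.
  have WZk : is_kernel (WZn W (n := n)) by apply: kernel_prod; exact: WZ_kernel.
  have -> : leakage W PM (fun _ x => (x == c)%:R) = mutinfo (fun m z => PM m * WZn W c z).
    by congr mutinfo; apply/funext => m; apply/funext => z; rewrite sum_point.
  apply: le_trans (mutinfo_le_div (P := fun=> WZn W c) (Q := WZn W c) (e := 0) PMP _ _ _ _) _ => //.
  + move=> m; apply: le_trans (_ : 0 <= 0) => //; rewrite big1// => z _.
    have [->|wz] := eqVneq (WZn W c z) 0; first by rewrite mul0r.
    by rewrite divff// ln1 mulr0.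
  + by rewrite mul0r ltW.
Qed.

Lemma capacity_le (leak leak' : forall n K, ('I_K -> {ffun 'I_n -> X} -> R) -> \bar R) b :
  (forall Rt, achievable W cost leak b Rt -> achievable W cost leak' b Rt) ->
  (capacity W cost leak b <= capacity W cost leak' b)%E.
Proof.
by move=> H; apply: ereal_sup_le => _ [Rt aRt <-]; exists Rt => //; exact: H.
Qed.

Lemma achievable_sem_str b Rt : achievable W cost (@leak_sem R X Y Z W) b Rt ->
  achievable W cost (@leak_str R X Y Z W) b Rt.
Proof.
move=> [Rt0 H]; split=> // eps /H [N HN]; exists N => n /HN [f [g [fv [fe fl]]]].
exists f, g; split=> //; split=> //; apply: le_trans fl.
have K0 := msize_gt0 n Rt0.
apply: ereal_sup_ubound; exists (@unifM R _) => //; split=> [m|].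
  by rewrite invr_ge0.
by rewrite sumr_const card_ord -[LHS]mulr_natr mulVf// pnatr_eq0 -lt0n.
Qed.

Lemma achievable_str_weak b Rt : achievable W cost (@leak_str R X Y Z W) b Rt ->
  achievable W cost (@leak_weak R X Y Z W) b Rt.
Proof.
move=> [Rt0 H]; split=> // eps eps0; have [N HN] := H eps eps0.
exists (maxn N 1) => n; rewrite geq_max => /andP[/HN [f [g [fv [fe fl]]]] n1].
exists f, g; split=> //; split=> //; rewrite lee_fin in fl; rewrite lee_fin.
have np : 0 < n%:R :> R by rewrite ltr0n.
rewrite mulrC ler_pdivrMr//; apply: le_trans fl _.
by rewrite ler_peMr ?ler1n// ltW.
Qed.

End Capacity.

Theorem theorem1 (R : realType) (X Y Z : finType) (W : X -> Y -> Z -> R)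
    (cost : X -> R) (b : R) (x0 : X) :
  is_channel W ->
  (forall x, 0 <= cost x) ->
  cmin cost x0 <= b ->
  C_sem W cost b = C_str W cost b /\
  C_str W cost b = C_weak W cost b /\
  C_weak W cost b = Cbar W cost b.

Proof.
move=> WP cost0 cb.
have [xm costm] : exists xm, forall x, cost xm <= cost x.
  case: (@arg_minP _ _ X x0 xpredT cost isT) => xm _ H.
  by exists xm => x; exact: H.
have mb : cost xm <= b by apply: le_trans cb; apply: le_bigmin.
have h1 : (C_sem W cost b <= C_str W cost b)%E.
  by apply: capacity_le => Rt; exact: achievable_sem_str.
have h2 : (C_str W cost b <= C_weak W cost b)%E.
  by apply: capacity_le => Rt; exact: achievable_str_weak.
have h3 : (C_weak W cost b <= Cbar W cost b)%E.
  by apply: ge_ereal_sup => _ [Rt aRt <-]; exact: (weak_rate_bound WP x0).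
have h4 : (Cbar W cost b <= C_sem W cost b)%E.
  apply: ge_ereal_sup => _ [r [U [V [pUV [q [pP [qP [qb rE]]]]]]] <-].
  have le_sem Rt : achievable W cost (@leak_sem R X Y Z W) b Rt -> (Rt%:E <= C_sem W cost b)%E.
    by move=> aRt; apply: ereal_sup_ubound; exists Rt.
  (* Achievability holds strictly below each value, so the value is approached through [r - e]; if
     that is negative, rate 0 suffices. *)
  apply/lee_addgt0Pr => e e0; rewrite -leeBlDr// -EFinB.
  have [re|re] := leP 0 (r - e).
    apply: le_sem; apply: (achievable_secrecy_value WP cost0 costm mb pP qP qb re).
    by rewrite -rE ltrBlDr ltrDl.
  by apply: le_trans (le_sem _ (achievable_zero WP mb)); rewrite lee_fin ltW.
have e1 : C_sem W cost b = Cbar W cost b.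
  by apply/eqP; rewrite eq_le h4 (le_trans h1)// (le_trans h2).
have e2 : C_str W cost b = Cbar W cost b.
  by apply/eqP; rewrite eq_le (le_trans h2)// -e1.
have e3 : C_weak W cost b = Cbar W cost b.
  by apply/eqP; rewrite eq_le h3 -e2.
by rewrite e1 e2 e3.
Qed.
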